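(* Let $k_0$ be any field and $p$ an odd prime number. The algebra of operations $K^{M}_i(k)/p \to K^{M}_*(k)/p$ commuting with field extensions over $k_0$ is: \begin{itemize} \item if $i=0$, the free $K^{M}_*(k_0)/p$-module of rank $p$ of functions $\mathbf{F}_p \to K^{M}_*(k_0)/p$; \item if $i\geq 1$ is odd, the free $K^{M}_*(k_0)/p$-module $K^{M}_*(k_0)/p\cdot\gamma_0 \oplus K^{M}_*(k_0)/p\cdot\gamma_1$; \item if $i\geq 2$ is even, the free $K^{M}_*(k_0)/p$-module $\bigoplus_{n\geq 0} K^{M}_*(k_0)/p\cdot \gamma_n$. \end{itemize}
   Context: For a field $k$, $K^M_n(k)$ is the Milnor $K$-group: the quotient of $(k^\times)^{\otimes n}$ by the relations $a_1\otimes\cdots\otimes a_n=0$ whenever $a_r+a_s=1$ for some $r<s$; the image of $a_1\otimes\cdots\otimes a_n$ is denoted $\{a_1,\ldots,a_n\}$ and called a symbol. $K^M_0(k)=\mathbf{Z}$, and $K^M_*(k)=\bigoplus_{n\ge0}K^M_n(k)$ is a graded ring under the product induced by concatenation. $K^M_n(k)/p$ is the quotient by $p$. An operation $K^M_i/p\to K^M_*/p$ over $k_0$ is a natural transformation from the functor $K^M_i/p$ from field extensions of $k_0$ to sets, to the functor $K^M_*/p$ from field extensions of $k_0$ to $\mathbf{F}_p$-algebras; that is, a family of functions (not assumed additive) $\varphi:K^M_i(k)/p\to K^M_*(k)/p$, one for each extension $k/k_0$, compatible with the maps induced by extensions of fields $k\subset l$ over $k_0$. Operations are added and multiplied pointwise,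 and form a module over $K^M_*(k_0)/p$ via $(a\cdot\varphi)(x)=a_k\cdot\varphi(x)$ for $x\in K^M_i(k)/p$, where $a_k$ is the image of $a$ in $K^M_*(k)/p$. A function $f:\mathbf{F}_p\to K^M_*(k_0)/p$ gives the operation $x\mapsto f(x)$ on $K^M_0(k)/p=\mathbf{F}_p$. Divided powers: for $x=s_1+\cdots+s_l$ a sum of symbols in $K^M_i(k)/p$, $\gamma_n(x)=\sum_{1\le l_1<\cdots<l_n\le l}s_{l_1}\cdots s_{l_n}\in K^M_{ni}(k)/p$. Always $\gamma_0(x)=1$ and $\gamma_1(x)=x$; for $p$ odd and $i\ge2$ even, $\gamma_n(x)$ does not depend on the chosen decomposition of $x$, for every $n$.
   Formalization: For even i ≥ 2 the claim fails for all operations (x ↦ Σγ_n(x) is no finite combination); proved instead: the γ_n are a basis of the operations of bounded degree, and every operation is a unique pointwise-finite series Σ a_n γ_n, each such series being an operation. *)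

(* Defs.v *)
From HB Require Import structures.
From mathcomp Require Import all_boot all_order all_algebra.
From mathcomp Require Import generic_quotient ring_quotient.
From mathcomp Require Import finmap monalg boolp.

Set Implicit Arguments.
Unset Strict Implicit.
Unset Printing Implicit Defensive.

Import GRing.Theory.

Local Open Scope ring_scope.
Local Open Scope quotient_scope.

(** * The Milnor K-ring of a field *)

Definition mulgrp (k : fieldType) : Type := {x : k | x != 0}.
HB.instance Definition _ (k : fieldType) := Choice.on (mulgrp k).

(* Words over [k^x] form a free monoid: the word [:: a_1; ..; a_n] stands for
   a_1 (x) .. (x) a_n, and the ring [{malg int[seq (mulgrp k)]}] is the direct
   sum over n of the free abelian groups on (k^x)^n, with concatenation as
   product. *)
Lemma cat_eq_nil (T : Type) (s t : seq T) :
  s ++ t = [::] -> s = [::] /\ t = [::].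
Proof. by case: s; case: t. Qed.

HB.instance Definition _ (k : fieldType) :=
  @Choice_isMonomialDef.Build (seq (mulgrp k)) [::] cat
    (@catA _) (@cat0s _) (@cats0 _) (@cat_eq_nil _).

Notation words k := (seq (mulgrp k)).
Notation wordring k := {malg int[words k]}.

(* The relations defining K_*/m: multilinearity, the Steinberg relation for two
   arbitrary (not only adjacent) positions, and m = 0. They are homogeneous, so
   that the quotient is the direct sum of the quotients in each degree; m = 0
   gives the integral Milnor K-ring. *)
Inductive milnor_rel (m : nat) (k : fieldType) : wordring k -> Prop :=
| MilnorRel0 : milnor_rel m 0
| MilnorRelB x y : milnor_rel m x -> milnor_rel m y -> milnor_rel m (x - y)
| MilnorRelTensor (s t : words k) (a b c : mulgrp k) :
    val c = val a * val b ->
    milnor_rel m (<< s ++ c :: t >> - << s ++ a :: t >> - << s ++ b :: t >>)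
| MilnorRelSteinberg (s t u : words k) (a b : mulgrp k) :
    val a + val b = 1 ->
    milnor_rel m << s ++ a :: t ++ b :: u >>
| MilnorRelMod x : milnor_rel m (x *+ m).

Definition milnor_ideal (m : nat) (k : fieldType) : {pred wordring k} :=
  fun x => `[< milnor_rel m x >].
Arguments milnor_ideal : clear implicits.

Lemma milnor_idealP m k x : reflect (milnor_rel m x) (x \in milnor_ideal m k).
Proof. exact: asboolP. Qed.

Lemma milnor_ideal_zmod_closed m k : zmod_closed (milnor_ideal m k).
Proof.
split=> [|x y /milnor_idealP hx /milnor_idealP hy]; apply/milnor_idealP.
  exact: MilnorRel0.
exact: MilnorRelB.
Qed.

HB.instance Definition _ m k :=
  GRing.isZmodClosed.Build (wordring k) (milnor_ideal m k)
    (milnor_ideal_zmod_closed m k).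

Lemma mulUU (k : fieldType) (s t : words k) :
  << s >> * << t >> = << s ++ t >> :> wordring k.
Proof. by rewrite malgM_def fgmulUU mulr1. Qed.

Lemma milnor_idealUl m k (s : words k) x :
  x \in milnor_ideal m k -> << s >> * x \in milnor_ideal m k.
Proof.
move=> /milnor_idealP; elim=> {x}
  [|x y _ IHx _ IHy|t u a b c e|t u v a b e|x].
- by rewrite mulr0 rpred0.
- by rewrite mulrBr; apply: rpredB.
- rewrite !mulrBr !mulUU !catA; apply/milnor_idealP.
  exact: MilnorRelTensor.
- by rewrite mulUU catA; apply/milnor_idealP; apply: MilnorRelSteinberg.
- by apply/milnor_idealP; rewrite mulrnAr; apply: MilnorRelMod.
Qed.

Lemma milnor_idealUr m k (s : words k) x :
  x \in milnor_ideal m k -> x * << s >> \in milnor_ideal m k.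
Proof.
move=> /milnor_idealP; elim=> {x}
  [|x y _ IHx _ IHy|t u a b c e|t u v a b e|x].
- by rewrite mul0r rpred0.
- by rewrite mulrBl; apply: rpredB.
- rewrite !mulrBl !mulUU -!catA !cat_cons; apply/milnor_idealP.
  exact: MilnorRelTensor.
- rewrite mulUU -catA cat_cons -catA cat_cons; apply/milnor_idealP.
  exact: MilnorRelSteinberg.
- by apply/milnor_idealP; rewrite mulrnAl; apply: MilnorRelMod.
Qed.

Lemma wordringE (k : fieldType) (x : wordring k) :
  x = \sum_(w <- msupp x) << w >> *~ x@_w.
Proof.
rewrite [LHS]monalgE; apply: eq_bigr => w _.
by rewrite -[RHS](raddfMz (mkmalgU w)) intz.
Qed.

Lemma milnor_idealMl m k y x :
  x \in milnor_ideal m k -> y * x \in milnor_ideal m k.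
Proof.
move=> hx; rewrite [y]wordringE mulr_suml rpred_sum // => w _.
by rewrite mulrzAl rpredMz // milnor_idealUl.
Qed.

Lemma milnor_idealMr m k y x :
  x \in milnor_ideal m k -> x * y \in milnor_ideal m k.
Proof.
move=> hx; rewrite [y]wordringE mulr_sumr rpred_sum // => w _.
by rewrite mulrzAr rpredMz // milnor_idealUr.
Qed.

(* [KM m k] is K_*(k)/m; the case m = 0 is K_*(k) itself. *)
Definition KM (m : nat) (k : fieldType) : Type :=
  Quotient.quot (milnor_ideal m k).
HB.instance Definition _ m k := GRing.Zmodule.on (KM m k).
HB.instance Definition _ m k :=
  ZmodQuotient.on (KM m k).

Section KMRing.
Variables (m : nat) (k : fieldType).

Lemma KM_pi_eq (x y : wordring k) :
  (\pi_(KM m k) x == \pi_(KM m k) y) = (x - y \in milnor_ideal m k).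
Proof. by rewrite -Quotient.idealrBE. Qed.

Definition KM_one : KM m k := \pi_(KM m k) 1.
Definition KM_mul (x y : KM m k) : KM m k := \pi_(KM m k) (repr x * repr y).

Lemma KM_pi_mul (x y : wordring k) :
  KM_mul (\pi_(KM m k) x) (\pi_(KM m k) y) = \pi_(KM m k) (x * y).
Proof.
apply/eqP; rewrite KM_pi_eq.
set x' := repr _; set y' := repr _.
have hx : x' - x \in milnor_ideal m k by rewrite -KM_pi_eq reprK.
have hy : y' - y \in milnor_ideal m k by rewrite -KM_pi_eq reprK.
have -> : x' * y' - x * y = (x' - x) * y' + x * (y' - y).
  by rewrite mulrBl mulrBr addrA subrK.
by rewrite rpredD //; [apply: milnor_idealMr | apply: milnor_idealMl].
Qed.

Lemma KM_mulA : associative KM_mul.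
Proof.
move=> x y z; rewrite -[x]reprK -[y]reprK -[z]reprK.
move: (repr x) (repr y) (repr z) => a b c.
by rewrite (KM_pi_mul b c) (KM_pi_mul a b) (KM_pi_mul a) (KM_pi_mul _ c) mulrA.
Qed.

Lemma KM_mul1 : left_id KM_one KM_mul.
Proof. by move=> x; rewrite -[x]reprK KM_pi_mul mul1r. Qed.

Lemma KM_1mul : right_id KM_one KM_mul.
Proof. by move=> x; rewrite -[x]reprK KM_pi_mul mulr1. Qed.

Lemma KM_mulDl : left_distributive KM_mul +%R.
Proof.
move=> x y z; rewrite -[x]reprK -[y]reprK -[z]reprK.
by rewrite -raddfD !KM_pi_mul mulrDl raddfD.
Qed.

Lemma KM_mulDr : right_distributive KM_mul +%R.
Proof.
move=> x y z; rewrite -[x]reprK -[y]reprK -[z]reprK.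
by rewrite -raddfD !KM_pi_mul mulrDr raddfD.
Qed.

HB.instance Definition _ := GRing.Zmodule_isPzRing.Build (KM m k)
  KM_mulA KM_mul1 KM_1mul KM_mulDl KM_mulDr.

End KMRing.

(* The subgroup of [KM m k] spanned by the symbols whose length satisfies [D]:
   K_n(k)/m for [D := pred1 n], and the sum of the K_j(k)/m, j <= d, for
   [D := fun j => j <= d]. *)
Definition KM_part (m : nat) (k : fieldType) (D : pred nat) : {pred KM m k} :=
  fun x => `[< exists2 g : wordring k,
                 x = \pi_(KM m k) g & forall w, w \in msupp g -> D (size w) >].

Lemma KM_part_zmod_closed m k D : zmod_closed (@KM_part m k D).
Proof.
split=> [|x y /asboolP[g -> hg] /asboolP[h -> hh]]; apply/asboolP.
  by exists 0; [rewrite raddf0 | move=> w; rewrite msupp0 in_fset0].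
exists (g - h) => [|w /(fsubsetP (msuppB_le g h))]; first by rewrite raddfB.
by rewrite in_fsetU => /orP[/hg | /hh].
Qed.

HB.instance Definition _ m k D :=
  GRing.isZmodClosed.Build (KM m k) (@KM_part m k D)
    (@KM_part_zmod_closed m k D).

(* K_n(k)/m, as a subgroup of K_*(k)/m. *)
Definition KMdeg (m n : nat) (k : fieldType) : Type :=
  {x : KM m k | x \in @KM_part m k (pred1 n)}.
HB.instance Definition _ m n k := SubChoice.on (KMdeg m n k).
HB.instance Definition _ m n k :=
  [SubChoice_isSubZmodule of KMdeg m n k by <:].

Lemma symbol_subproof m k n (t : n.-tuple (mulgrp k)) :
  \pi_(KM m k) << tval t >> \in @KM_part m k (pred1 n).
Proof.
apply/asboolP; exists << tval t >> => // w.
by rewrite msuppU1 in_fset1 => /eqP->; rewrite /= size_tuple.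
Qed.

Definition symbol (m : nat) (k : fieldType) (n : nat)
    (t : n.-tuple (mulgrp k)) : KMdeg m n k :=
  Sub (\pi_(KM m k) << tval t >>) (symbol_subproof m t).

(** * Functoriality *)

Section KMMap.
Variables (m : nat) (k l : fieldType) (f : {rmorphism k -> l}).

Lemma mulgrp_map_subproof (a : mulgrp k) : f (val a) != 0.
Proof. by rewrite fmorph_eq0 (valP a). Qed.

Definition mulgrp_map (a : mulgrp k) : mulgrp l :=
  Sub (f (val a)) (mulgrp_map_subproof a).

Definition word_map : wordring k -> wordring l :=
  mmap (@malgC (words l) int) (fun w => << map mulgrp_map w >>).

Lemma word_mapU w : word_map << w >> = << map mulgrp_map w >>.
Proof. by rewrite /word_map mmapU; apply: (mulUU [::]). Qed.

Lemma word_map_is_zmod_morphism : zmod_morphism word_map.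
Proof. exact: mmap_is_additive. Qed.
HB.instance Definition _ :=
  GRing.isZmodMorphism.Build _ _ word_map word_map_is_zmod_morphism.

Lemma word_mapE x :
  word_map x = \sum_(w <- msupp x) << map mulgrp_map w >> *~ x@_w.
Proof.
rewrite [in LHS](wordringE x) [LHS](raddf_sum word_map).
by apply: eq_bigr => w _; rewrite (raddfMz word_map) /= word_mapU.
Qed.

Lemma word_map_is_monoid_morphism : monoid_morphism word_map.
Proof.
have UM v y : word_map (<< v >> * y) = << map mulgrp_map v >> * word_map y.
  rewrite {1}(wordringE y) mulr_sumr (raddf_sum word_map) (word_mapE y).
  rewrite mulr_sumr; apply: eq_bigr => w _.
  rewrite !mulrzAr (raddfMz word_map) /= !mulUU word_mapU.
  by rewrite map_cat.
split=> [|x y]; first exact: (word_mapU [::]).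
rewrite {1}(wordringE x) mulr_suml (raddf_sum word_map) (word_mapE x).
rewrite mulr_suml; apply: eq_bigr => v _.
by rewrite !mulrzAl (raddfMz word_map) /= UM.
Qed.
HB.instance Definition _ :=
  GRing.isMonoidMorphism.Build _ _ word_map word_map_is_monoid_morphism.

Lemma word_map_ideal x :
  x \in milnor_ideal m k -> word_map x \in milnor_ideal m l.
Proof.
move=> /milnor_idealP; elim=> {x}
  [|x y _ IHx _ IHy|s t a b c e|s t u a b e|x].
- by rewrite (raddf0 word_map) rpred0.
- by rewrite (raddfB word_map); exact: (rpredB IHx IHy).
- rewrite !(raddfB word_map) /= !word_mapU !map_cat !map_cons; apply/milnor_idealP.
  by apply: MilnorRelTensor; rewrite /= e rmorphM.
- rewrite word_mapU map_cat map_cons map_cat map_cons; apply/milnor_idealP.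
  by apply: MilnorRelSteinberg; rewrite /= -rmorphD e rmorph1.
- by rewrite (raddfMn word_map); apply/milnor_idealP; apply: MilnorRelMod.
Qed.

Definition KM_map (x : KM m k) : KM m l := \pi_(KM m l) (word_map (repr x)).

Lemma KM_map_pi x : KM_map (\pi_(KM m k) x) = \pi_(KM m l) (word_map x).
Proof.
apply/eqP; rewrite KM_pi_eq -(raddfB word_map); apply: word_map_ideal.
by rewrite -KM_pi_eq reprK.
Qed.

Lemma KM_map_is_zmod_morphism : zmod_morphism KM_map.
Proof.
move=> x y; rewrite -[x]reprK -[y]reprK.
by rewrite -raddfB !KM_map_pi raddfB /= raddfB.
Qed.
HB.instance Definition _ :=
  GRing.isZmodMorphism.Build (KM m k) (KM m l) KM_map KM_map_is_zmod_morphism.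

Lemma KM_map_is_monoid_morphism : monoid_morphism KM_map.
Proof.
split=> [|x y]; first by rewrite [LHS]KM_map_pi rmorph1.
rewrite -[x]reprK -[y]reprK [_ * _]KM_pi_mul !KM_map_pi rmorphM /=.
by apply/esym; apply: KM_pi_mul.
Qed.
HB.instance Definition _ :=
  GRing.isMonoidMorphism.Build (KM m k) (KM m l) KM_map
    KM_map_is_monoid_morphism.

Lemma KM_map_part D x : x \in @KM_part m k D -> KM_map x \in @KM_part m l D.
Proof.
move=> /asboolP[g -> hg]; rewrite KM_map_pi word_mapE raddf_sum /= big_seq.
apply: rpred_sum => w wg; have hw := hg w wg.
rewrite raddfMz rpredMz //; apply/asboolP.
exists << map mulgrp_map w >> => // v.
by rewrite msuppU1 in_fset1 => /eqP->; rewrite size_map.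
Qed.

Definition KMdeg_map (n : nat) (x : KMdeg m n k) : KMdeg m n l :=
  Sub (KM_map (val x)) (KM_map_part (valP x)).

End KMMap.

Lemma KM_map_comp m (j k l : fieldType) (f : {rmorphism j -> k})
    (g : {rmorphism j -> l}) (h : {rmorphism k -> l}) (x : KM m j) :
  (forall a, h (f a) = g a) -> KM_map h (KM_map f x) = KM_map g x.
Proof.
move=> hfg; rewrite -[x]reprK; move: (repr x) => {}x.
rewrite (KM_map_pi m f) (KM_map_pi m g) (KM_map_pi m h).
congr (\pi_(KM m l) _).
rewrite (word_mapE f) (word_mapE g) (raddf_sum (word_map h)).
apply: eq_bigr => w _; rewrite (raddfMz (word_map h)) /= word_mapU -map_comp.
have E : mulgrp_map h \o mulgrp_map f =1 mulgrp_map g.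
  by move=> a; apply: val_inj; apply: hfg.
by rewrite (eq_map E).
Qed.

(** * Operations *)

Record operation (m i : nat) (k0 : fieldType) := Operation {
  op_fun :> forall k : fieldType,
    {rmorphism k0 -> k} -> KMdeg m i k -> KM m k;
  op_natural : forall (k l : fieldType) (f : {rmorphism k0 -> k})
      (g : {rmorphism k0 -> l}) (h : {rmorphism k -> l}),
    (forall a, h (f a) = g a) ->
    forall x : KMdeg m i k, KM_map h (op_fun f x) = op_fun g (KMdeg_map h x)
}.

Section Operations.
Variables (m i : nat) (k0 : fieldType).
Local Notation op := (operation m i k0).
Implicit Types (phi psi : op) (a : KM m k0).

Lemma operationP phi psi :
  (forall (k : fieldType) (f : {rmorphism k0 -> k}) x,
    phi k f x = psi k f x) -> phi = psi.
Proof.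
case: phi psi => [u hu] [v hv] /= e.
have {}e : u = v by do 3![apply: functional_extensionality_dep => ?].
by rewrite e in hu *; congr Operation; apply: Prop_irrelevance.
Qed.

Lemma op_zero_subproof (k l : fieldType) (f : {rmorphism k0 -> k})
    (g : {rmorphism k0 -> l}) (h : {rmorphism k -> l}) :
  (forall b, h (f b) = g b) -> forall x : KMdeg m i k,
  KM_map h 0 = 0 :> KM m l.
Proof. by move=> _ _; rewrite raddf0. Qed.
Definition op_zero : op := Operation op_zero_subproof.

Lemma op_add_subproof phi psi (k l : fieldType) (f : {rmorphism k0 -> k})
    (g : {rmorphism k0 -> l}) (h : {rmorphism k -> l}) :
  (forall b, h (f b) = g b) -> forall x : KMdeg m i k,
  KM_map h (phi k f x + psi k f x) =
    phi l g (KMdeg_map h x) + psi l g (KMdeg_map h x).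
Proof. by move=> e x; rewrite (raddfD (KM_map h)) /= !(op_natural _ e). Qed.
Definition op_add phi psi : op := Operation (op_add_subproof phi psi).

Lemma op_mul_subproof phi psi (k l : fieldType) (f : {rmorphism k0 -> k})
    (g : {rmorphism k0 -> l}) (h : {rmorphism k -> l}) :
  (forall b, h (f b) = g b) -> forall x : KMdeg m i k,
  KM_map h (phi k f x * psi k f x) =
    phi l g (KMdeg_map h x) * psi l g (KMdeg_map h x).
Proof. by move=> e x; rewrite (rmorphM (KM_map h)) /= !(op_natural _ e). Qed.
Definition op_mul phi psi : op := Operation (op_mul_subproof phi psi).

Lemma op_scale_subproof a phi (k l : fieldType) (f : {rmorphism k0 -> k})
    (g : {rmorphism k0 -> l}) (h : {rmorphism k -> l}) :
  (forall b, h (f b) = g b) -> forall x : KMdeg m i k,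
  KM_map h (KM_map f a * phi k f x) = KM_map g a * phi l g (KMdeg_map h x).
Proof.
move=> e x; rewrite (rmorphM (KM_map h)) /=.
by rewrite (op_natural _ e) (KM_map_comp _ e).
Qed.
Definition op_scale a phi : op := Operation (op_scale_subproof a phi).

Definition op_lincomb (I : Type) (b : I -> op) (s : seq I) (a : I -> KM m k0) :
    op :=
  \big[op_add/op_zero]_(n <- s) op_scale (a n) (b n).

Definition op_span (I : Type) (b : I -> op) (phi : op) : Prop :=
  exists (s : seq I) (a : I -> KM m k0), phi = op_lincomb b s a.

Definition op_free (I : eqType) (b : I -> op) : Prop :=
  forall (s : seq I) (a : I -> KM m k0),
    uniq s -> op_lincomb b s a = op_zero -> forall n, n \in s -> a n = 0.

Definition op_basis (I : eqType) (b : I -> op) : Prop :=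
  op_free b /\ forall phi, op_span b phi.

(* Values in the sum of the K_j/m, j <= d, with d uniform in the extension and
   in the argument. An operation is only pointwise a finite sum of homogeneous
   ones, so not every operation is bounded: if i >= 2 is even, then
   x |-> \sum_n gamma_n(x) is a pointwise finite, unbounded operation. *)
Definition op_bounded (phi : op) : Prop :=
  exists d : nat, forall (k : fieldType) (f : {rmorphism k0 -> k}) x,
    phi k f x \in @KM_part m k (fun j => j <= d)%N.

(* [phi] is the pointwise finite sum of the a_n b_n: for each argument the
   partial sums are eventually equal to its value. *)
Definition op_series (b : nat -> op) (a : nat -> KM m k0) (phi : op) : Prop :=
  forall (k : fieldType) (f : {rmorphism k0 -> k}) x,
    exists N : nat, forall M : nat, (N <= M)%N ->
      phi k f x = \sum_(n < M) KM_map f (a n) * b n k f x.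

(* [phi] sends a sum of symbols s_1 + .. + s_l to the sum of the products
   s_(l_1) .. s_(l_n), l_1 < .. < l_n, for every such decomposition; the
   product over A below runs through A in increasing order. *)
Definition divided_power (n : nat) (phi : op) : Prop :=
  forall (k : fieldType) (f : {rmorphism k0 -> k})
      (s : seq (i.-tuple (mulgrp k))),
    phi k f (\sum_(t <- s) symbol m t) =
      \sum_(A : {set 'I_(size s)} | #|A| == n)
         \prod_(j in A) val (symbol m (tnth (in_tuple s) j)).

End Operations.

(* Main.v *)
Require Import Defs.
From HB Require Import structures.
From mathcomp Require Import all_boot all_order all_algebra.
From mathcomp Require Import generic_quotient ring_quotient.
From mathcomp Require Import finmap monalg boolp.
From mathcomp Require Import zify.

Set Implicit Arguments.
Unset Strict Implicit.
Unset Printing Implicit Defensive.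

Import GRing.Theory.
Local Open Scope ring_scope.
Local Open Scope quotient_scope.

(* Unification should compare elements of the quotient ring without unfolding
   its operations. *)
Opaque KM_map KM_mul KM_one Quotient.add Quotient.opp Quotient.zero.

(** Since p is odd, -1 is a p-th power, so that {-1} = 0 and {a}{a} = 0 in
    K_*(k)/p. The heart of the proof is that a natural function Psi of a unit a,
    with values in K_*/p, that only depends on a modulo p-th powers and vanishes
    at a = 1, has the form Psi(a) = b {a} for a unique b in K_*(k_0)/p. Indeed
    let x be its value at the generic point t, an element of K_*(k_0(t))/p. For
    a unit a of an extension k, the substitution t -> a u^p embeds k_0(t) in
    k(u) and sends x to Psi(a u^p) = Psi(a). Specialising at u = infinity
    recovers Psi(a), as this element comes from k. On the other hand a rational
    function f(a u^p) is seen at infinity only through its leading coefficient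
    and its degree, so that the specialisation of the image of x is
    s(x) + r(x) {a}, with s and r the specialisation and the residue of x at
    t = infinity (spec_subst, natural_one_variable). The residue also gives the
    uniqueness of b: multiplication by {t} followed by the residue is the
    identity on K_*(k_0)/p (coef_part). Adding the variables one at a time, a
    natural function of several units with these properties in each of them is
    b times their symbol (natural_multilinear).

    For an operation phi on K_i/p and a point x over k, the function
    s |-> phi(x + s) - phi(x) of a symbol s is of this kind over k. Hence
    phi(x + s) = phi(x) + phi'(x) s, and uniqueness makes the coefficient phi'
    an operation again (op_deriv). As elements are sums of symbols when i > 0,
    phi is determined by the values at 0 of its iterated derivatives.

    If i is odd, symbols s and s' of length i anticommute, whereas
    phi(x + s + s') is symmetric; so 2 phi''(x) s s' = 0 for all s and s', which
    gives phi'' = 0 and phi(x) = phi(0) + phi'(0) x (op_odd).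

    If i >= 2 is even, symbols of length i commute and have square zero, and the
    product of two symbols that differ in one entry vanishes. Therefore
    s |-> 1 + s T extends to a homomorphism from K_i/p to the multiplicative
    group of polynomials in T over the even part of K_*/p (exponential), whose
    coefficients are the divided powers. They satisfy
    gamma_(n+1)(x + s) = gamma_(n+1)(x) + gamma_n(x) s, so that phi is the sum
    of the phi^(n)(0) gamma_n (op_taylor) and the coefficients of such a sum are
    unique (series_at_inj). Since the derivative lowers the degree by i, bounded
    operations are the finite sums.

    If i = 0, there is nothing to vary: K_0/p is F_p over every field, and an
    operation is determined by its values over k_0 (op_of_ffunP). *)

(** * Symbols of length one and graded commutativity *)

(** The symbol {x}, extended by {0} = 0, so that the Steinberg relation and
    the compatibility with field extensions hold without side conditions. *)
HB.lock Definition sym (m : nat) (k : fieldType) (x : k) : KM m k :=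
  \pi_(KM m k) (if insub x is Some a then << [:: a : mulgrp k] >> else 0).

Section Anticommuting.
Variables (R : pzRingType) (T : Type) (s : T -> R).
Hypothesis s_anti : forall a b, s a * s b = - (s b * s a).

Lemma anti_word a (w : seq T) :
  s a * \prod_(b <- w) s b = (-1) ^+ size w * (\prod_(b <- w) s b * s a).
Proof.
elim: w => [|b w IHw]; first by rewrite big_nil mulr1 !mul1r.
rewrite big_cons exprS [LHS]mulrA s_anti [LHS]mulNr -[in LHS]mulrA IHw mulN1r mulNr.
by congr (- _); rewrite !mulrA commr_sign.
Qed.

Lemma anti_cons (a b P Q : R) :
  a * b = - (b * a) -> a * P = Q * a -> a * (b * P) = - b * Q * a.
Proof. by move=> ab aP; rewrite mulrA ab !mulNr -!mulrA aP. Qed.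

Lemma anti_words (v w : seq T) :
  \prod_(b <- v) s b * \prod_(b <- w) s b =
  (-1) ^+ (size v * size w) * (\prod_(b <- w) s b * \prod_(b <- v) s b).
Proof.
elim: v => [|a v IHv]; first by rewrite big_nil mul0n mulr1 !mul1r.
rewrite big_cons -mulrA IHv /= mulSn addnC exprD -!mulrA.
rewrite [LHS]mulrA commr_sign -!mulrA; congr (_ * _).
by rewrite mulrA anti_word -!mulrA.
Qed.

End Anticommuting.

Section Symbols.
Variables (m : nat) (k : fieldType).
Local Notation sym := (@sym m k).

Lemma pi_rel (x : wordring k) : milnor_rel m x -> \pi_(KM m k) x = 0.
Proof.
move=> h; apply/eqP; rewrite -[0](raddf0 (\pi_(KM m k))) KM_pi_eq subr0.
exact/milnor_idealP.
Qed.

Lemma piM (x y : wordring k) :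
  \pi_(KM m k) (x * y) = \pi_(KM m k) x * \pi_(KM m k) y.
Proof. by rewrite [RHS]KM_pi_mul. Qed.

Lemma sym_val (a : mulgrp k) : sym (val a) = \pi_(KM m k) << [:: a] >>.
Proof. by rewrite sym.unlock valK. Qed.

Lemma sym0 : sym 0 = 0.
Proof. by rewrite sym.unlock insubF ?eqxx ?raddf0. Qed.

Lemma pi_word (w : words k) :
  \pi_(KM m k) << w >> = \prod_(a <- w) sym (val a).
Proof.
elim: w => [|a w IHw]; first by rewrite big_nil.
by rewrite big_cons -IHw sym_val -piM mulUU.
Qed.

Lemma mulgrpP (x : k) : x != 0 -> exists a : mulgrp k, x = val a.
Proof. by move=> x0; exists (Sub x x0). Qed.

Lemma symM x y : x != 0 -> y != 0 -> sym (x * y) = sym x + sym y.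
Proof.
move=> x0 y0; have /mulgrpP[c e] := mulf_neq0 x0 y0.
have [a ea] := mulgrpP x0; have [b eb] := mulgrpP y0.
rewrite e; rewrite ea eb in e *.
have h := pi_rel (MilnorRelTensor m [::] [::] (esym e)).
apply/eqP; rewrite -subr_eq0 opprD addrA !sym_val; apply/eqP.
by apply: etrans h; rewrite 2!(raddfB (\pi_(KM m k))).
Qed.

Lemma sym1 : sym 1 = 0.
Proof.
have /eqP := symM (oner_neq0 k) (oner_neq0 k).
by rewrite mulr1 -subr_eq0 opprD addrA subrr sub0r oppr_eq0 => /eqP.
Qed.

Lemma symV x : sym x^-1 = - sym x.
Proof.
have [->|x0] := eqVneq x 0; first by rewrite invr0 sym0 oppr0.
apply/eqP; rewrite -subr_eq0 opprK -symM ?invr_eq0 //.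
by rewrite mulVf // sym1.
Qed.

Lemma symX x n : x != 0 -> sym (x ^+ n) = sym x *+ n.
Proof.
move=> x0; elim: n => [|n IHn]; first by rewrite expr0 sym1 mulr0n.
by rewrite exprS symM ?expf_neq0 // IHn mulrS.
Qed.

Lemma symXz x (z : int) : x != 0 -> sym (x ^ z) = sym x *~ z.
Proof. by move=> x0; case: z => n; rewrite ?NegzE -?exprnN ?symV symX. Qed.

Lemma KM_mulrn (x : KM m k) : x *+ m = 0.
Proof.
rewrite -[x]reprK; move: (repr x) => g; rewrite -raddfMn.
exact/pi_rel/MilnorRelMod.
Qed.

Lemma sym_mulXm x y : y != 0 -> sym (x * y ^+ m) = sym x.
Proof.
move=> y0; have [->|x0] := eqVneq x 0; first by rewrite mul0r.
by rewrite symM ?expf_neq0 // symX // KM_mulrn addr0.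
Qed.

Lemma KM_part_ind (D : pred nat) (P : KM m k -> Prop) :
    P 0 -> (forall x y, P x -> P y -> P (x - y)) ->
    (forall w : words k, D (size w) -> P (\prod_(a <- w) sym (val a))) ->
  forall x, x \in @KM_part m k D -> P x.
Proof.
move=> P0 PB Pw.
have PN x : P x -> P (- x) by rewrite -sub0r; apply: PB.
have PD x y : P x -> P y -> P (x + y).
  by move=> hx /PN hy; rewrite -[y]opprK; apply: PB.
have PMn x n : P x -> P (x *+ n).
  by move=> Px; elim: n => [|n IHn] //; rewrite mulrSr; apply: (PD _ _).
move=> x /asboolP[g -> hg]; rewrite [g]wordringE raddf_sum /= big_seq.
elim/big_rec: _ => // w z wg; apply: (PD _ _).
rewrite raddfMz /= pi_word; have {}/Pw Pw := hg w wg.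
by case: (g@_w) => n; [exact: PMn | apply: PN; exact: PMn].
Qed.

Lemma KM_ind (P : KM m k -> Prop) :
    (forall x y, P x -> P y -> P (x - y)) ->
    (forall w : words k, P (\prod_(a <- w) sym (val a))) ->
  forall x, P x.
Proof.
move=> PB Pw x; have P0 : P 0 by have := PB _ _ (Pw [::]) (Pw [::]); rewrite addrN.
have: x \in KM_part predT by apply/asboolP; exists (repr x); rewrite ?reprK.
by move=> hx; elim/KM_part_ind: x / hx.
Qed.

Lemma word_part (D : pred nat) (w : words k) :
  D (size w) -> \prod_(a <- w) sym (val a) \in @KM_part m k D.
Proof.
move=> Dw; rewrite -pi_word; apply/asboolP; exists << w >> => // v.
by rewrite msuppU1 in_fset1 => /eqP->.
Qed.

Lemma one_part (D : pred nat) : D 0%N -> 1 \in @KM_part m k D.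
Proof. by move=> D0; have := @word_part D [::] D0; rewrite big_nil. Qed.

Lemma sym_part c : sym c \in @KM_part m k (pred1 1%N).
Proof.
have [->|/mulgrpP[a ->]] := eqVneq c 0; first by rewrite sym0 rpred0.
by have := @word_part (pred1 1%N) [:: a] isT; rewrite big_cons big_nil mulr1.
Qed.

Lemma KM_partS (D E : pred nat) (x : KM m k) :
  (forall n, D n -> E n) -> x \in KM_part D -> x \in KM_part E.
Proof.
move=> DE hx; elim/KM_part_ind: x / hx => [|x y|w /DE]; first exact: rpred0.
  exact: rpredB.
exact: word_part.
Qed.

Lemma KM_part_degreeP (x : KM m k) : exists d, x \in KM_part (fun j => j <= d)%N.
Proof.
elim/KM_ind: x => [x y [d hd] [e he]|w]; last by exists (size w); exact: word_part.
exists (maxn d e); apply: rpredB.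
  by apply: KM_partS hd => n; rewrite leq_max => ->.
by apply: KM_partS he => n; rewrite leq_max orbC => ->.
Qed.

Lemma KM_partM (D E C : pred nat) (x y : KM m k) :
    (forall a b, D a -> E b -> C (a + b)%N) ->
  x \in KM_part D -> y \in KM_part E -> x * y \in KM_part C.
Proof.
move=> DEC hx hy; elim/KM_part_ind: x / hx => [|x1 x2 h1 h2|v Dv].
- by rewrite mul0r rpred0.
- by rewrite mulrBl rpredB.
elim/KM_part_ind: y / hy => [|y1 y2 h1 h2|w Ew].
- by rewrite mulr0 rpred0.
- by rewrite mulrBr rpredB.
by rewrite -big_cat; apply: word_part; rewrite size_cat; apply: DEC.
Qed.

Lemma sym_steinberg x y : x + y = 1 -> sym x * sym y = 0.
Proof.
have [->|x0] := eqVneq x 0; first by rewrite sym0 mul0r.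
have [->|y0] := eqVneq y 0; first by rewrite sym0 mulr0.
move=> xy; pose a : mulgrp k := Sub x x0; pose b : mulgrp k := Sub y y0.
have e : val a + val b = 1 by [].
have /pi_rel := MilnorRelSteinberg m [::] [::] [::] e.
by rewrite pi_word !big_cons big_nil mulr1.
Qed.

Hypothesis m_odd : odd m.

Lemma symN1 : sym (-1) = 0.
Proof.
have n0 : -1 != 0 :> k by rewrite oppr_eq0 oner_eq0.
by have := sym_mulXm 1 n0; rewrite mul1r -signr_odd m_odd expr1 sym1.
Qed.

Lemma symN x : sym (- x) = sym x.
Proof.
have [->|x0] := eqVneq x 0; first by rewrite oppr0.
by rewrite -mulN1r symM ?oppr_eq0 ?oner_eq0 // symN1 add0r.
Qed.

(** {x}{-x} = 0 in any Milnor K-ring, because -x = (1 - x) / (1 - x^-1);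
    and {-x} = {x} as -1 is an m-th power. *)
Lemma sym_sqr x : sym x * sym x = 0.
Proof.
have [->|x0] := eqVneq x 0; first by rewrite sym0 mul0r.
have [->|x1] := eqVneq x 1; first by rewrite sym1 mul0r.
rewrite -{2}symN.
have u0 : 1 - x != 0 by rewrite subr_eq0 eq_sym.
have v0 : 1 - x^-1 != 0 by rewrite subr_eq0 eq_sym invr_eq1.
have -> : - x = (1 - x) * (1 - x^-1)^-1.
  by apply: (mulIf v0); rewrite mulfVK // mulrBr mulr1 mulNr mulfV // opprK addrC.
have st1 : sym x * sym (1 - x) = 0 by apply: sym_steinberg; rewrite addrC subrK.
have st2 : sym x^-1 * sym (1 - x^-1) = 0.
  by apply: sym_steinberg; rewrite addrC subrK.
rewrite (symM u0) ?invr_eq0 // (symV (1 - x^-1)) mulrDr st1 add0r.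
by rewrite mulrN -mulNr -(symV x).
Qed.

Lemma sym_anti x y : sym x * sym y = - (sym y * sym x).
Proof.
have [->|x0] := eqVneq x 0; first by rewrite sym0 mul0r mulr0 oppr0.
have [->|y0] := eqVneq y 0; first by rewrite sym0 mul0r mulr0 oppr0.
have := sym_sqr (x * y); rewrite symM // mulrDl !mulrDr !sym_sqr addr0 add0r.
by move/eqP; rewrite addr_eq0 => /eqP.
Qed.

Lemma sym_sandwich x z : sym x * z * sym x = 0.
Proof.
elim/KM_ind: z => [y z hy hz|w].
  by rewrite mulrBr mulrBl hy hz subr0.
have := anti_word (s := fun a : mulgrp k => sym (val a))
  (fun a b => sym_anti (val a) (val b)).
case: (eqVneq x 0) => [->|/mulgrpP[a ->] ->]; first by rewrite sym0 mulr0.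
by rewrite -!mulrA sym_sqr !mulr0.
Qed.

End Symbols.

(** Locked, so that unification never unfolds the terms built from it. *)
HB.lock Definition kmap (m : nat) (k l : fieldType) (f : {rmorphism k -> l}) :
  KM m k -> KM m l := KM_map f.

Lemma kmapE m (k l : fieldType) (f : {rmorphism k -> l}) (x : KM m k) :
  KM_map f x = kmap f x.
Proof. by rewrite kmap.unlock. Qed.

Lemma kmap_sym m (k l : fieldType) (f : {rmorphism k -> l}) x :
  kmap f (sym m x) = sym m (f x).
Proof.
rewrite kmap.unlock sym.unlock KM_map_pi; congr (\pi_(KM m l) _).
case: insubP => [a ax <-|]; last first.
  by rewrite negbK => /eqP->; rewrite raddf0 insubF ?rmorph0 ?eqxx.
have -> : f (val a) = val (mulgrp_map f a) by [].
by rewrite word_mapU valK.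
Qed.

Section KmapTheory.
Variables (m : nat) (k l : fieldType) (f : {rmorphism k -> l}).
Implicit Types x y : KM m k.

Lemma kmapB x y : kmap f (x - y) = kmap f x - kmap f y.
Proof. rewrite kmap.unlock; exact: (raddfB (@KM_map m k l f)). Qed.

Lemma kmapD x y : kmap f (x + y) = kmap f x + kmap f y.
Proof. rewrite kmap.unlock; exact: (raddfD (@KM_map m k l f)). Qed.

Lemma kmapN x : kmap f (- x) = - kmap f x.
Proof. rewrite kmap.unlock; exact: (raddfN (@KM_map m k l f)). Qed.

Lemma kmapMz x (z : int) : kmap f (x *~ z) = kmap f x *~ z.
Proof. rewrite kmap.unlock; exact: (raddfMz (@KM_map m k l f)). Qed.

Lemma kmap0 : kmap f 0 = 0 :> KM m l.
Proof. rewrite kmap.unlock; exact: (raddf0 (@KM_map m k l f)). Qed.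

Lemma kmapM x y : kmap f (x * y) = kmap f x * kmap f y.
Proof. rewrite kmap.unlock; exact: (rmorphM (@KM_map m k l f)). Qed.

Lemma kmap1 : kmap f 1 = 1 :> KM m l.
Proof. rewrite kmap.unlock; exact: (rmorph1 (@KM_map m k l f)). Qed.

Lemma kmap_word (w : words k) :
  kmap f (\prod_(a <- w) sym m (val a)) = \prod_(a <- w) sym m (f (val a)).
Proof.
elim: w => [|a w IHw]; first by rewrite !big_nil kmap1.
by rewrite !big_cons kmapM IHw kmap_sym.
Qed.

End KmapTheory.

Lemma kmap_id m (k : fieldType) (f : {rmorphism k -> k}) :
  (forall x, f x = x) -> forall x : KM m k, kmap f x = x.
Proof.
move=> fid; elim/KM_ind => [x y hx hy|w]; first by rewrite kmapB hx hy.
by rewrite kmap_word; apply: eq_bigr => a _; rewrite fid.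
Qed.

Lemma kmap_comp m (j k l : fieldType) (f : {rmorphism j -> k})
    (g : {rmorphism j -> l}) (h : {rmorphism k -> l}) (x : KM m j) :
  (forall a, h (f a) = g a) -> kmap h (kmap f x) = kmap g x.
Proof. by move=> e; rewrite kmap.unlock; apply: KM_map_comp. Qed.

Lemma kmap_part m (k l : fieldType) (f : {rmorphism k -> l}) D x :
  x \in @KM_part m k D -> kmap f x \in @KM_part m l D.
Proof. by rewrite kmap.unlock; apply: KM_map_part. Qed.

(** * The universal property *)

(** The Steinberg relation for non-adjacent positions follows from the adjacent
    one as soon as the images of the units anticommute. *)
Lemma KM_lift (m : nat) (k : fieldType) (R : pzRingType) (th : k -> R) :
    (forall x y, x != 0 -> y != 0 -> th (x * y) = th x + th y) ->
    (forall x y, x != 0 -> y != 0 -> th x * th y = - (th y * th x)) ->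
    (forall x y, x != 0 -> y != 0 -> x + y = 1 -> th x * th y = 0) ->
    (forall r : R, r *+ m = 0) ->
  {F : {rmorphism KM m k -> R} | forall x, x != 0 -> F (sym m x) = th x}.
Proof.
move=> thM thA thS Rm.
pose h (w : words k) := \prod_(a <- w) th (val a).
pose ev (g : wordring k) := \sum_(w <- msupp g) h w *~ g@_w.
have evW (d : {fset words k}) g :
    (msupp g `<=` d)%fset -> ev g = \sum_(w <- d) h w *~ g@_w.
  move=> le; rewrite [LHS](big_fset_incl _ le) // => w _.
  by move=> /mcoeff_outdom ->; rewrite mulr0z.
have evB : zmod_morphism ev.
  move=> g1 g2 /=; pose d := (msupp g1 `|` msupp g2)%fset.
  rewrite (evW d) ?msuppB_le // (evW d) ?fsubsetUl // (evW d) ?fsubsetUr //.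
  by rewrite -sumrB; apply: eq_bigr => w _; rewrite mcoeffB mulrzBr.
have evU w : ev << w >> = h w.
  by rewrite (evW [fset w]%fset) ?msuppU_le // big_seq_fset1 mcoeffUU.
have [evA evE] : {F : {additive wordring k -> R} | ev =1 F}.
  by exists (HB.pack_for {additive wordring k -> R} ev
    (GRing.isZmodMorphism.Build _ _ ev evB)).
have h_cat v w : h (v ++ w) = h v * h w by rewrite /h big_cat.
have h_cons (a : mulgrp k) w : h (a :: w) = th (val a) * h w by rewrite /h big_cons.
have h_comm (a : mulgrp k) w : th (val a) * h w = (-1) ^+ size w * (h w * th (val a)).
  have thA' (x y : mulgrp k) := thA _ _ (valP x) (valP y).
  exact: (anti_word thA').
have evI g : g \in milnor_ideal m k -> ev g = 0.
  move=> /milnor_idealP; elim=> {g} [|x y _ hx _ hy|s t a b c e|s t u a b e|x].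
  - by rewrite evE raddf0.
  - by rewrite evE raddfB /= -!evE hx hy subr0.
  - rewrite evE !raddfB /= -!evE !evU !h_cat !h_cons -!mulrBr e.
    rewrite thM ?(valP a) ?(valP b) // mulrDl [_ + _ * h t]addrC addrK.
    by rewrite subrr mulr0.
  - rewrite evU h_cat h_cons h_cat h_cons [X in _ * X]mulrA h_comm -!mulrA.
    by rewrite [X in h t * X]mulrA thS ?(valP a) ?(valP b) // mul0r !mulr0.
  - by rewrite evE raddfMn /= Rm.
have evM g1 g2 : ev (g1 * g2) = ev g1 * ev g2.
  have UM v y : ev (<< v >> * y) = h v * ev y.
    rewrite {1}(wordringE y) mulr_sumr evE raddf_sum /= mulr_sumr.
    apply: eq_bigr => w _.
    by rewrite mulrzAr raddfMz /= -evE mulUU evU h_cat mulrzAr.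
  rewrite {1}(wordringE g1) mulr_suml evE raddf_sum /= mulr_suml.
  by apply: eq_bigr => w _; rewrite mulrzAl raddfMz /= -evE UM mulrzAl.
pose F (x : KM m k) := ev (repr x).
have Fpi g : F (\pi_(KM m k) g) = ev g.
  apply/eqP; rewrite -subr_eq0 -evB; apply/eqP/evI.
  by rewrite -KM_pi_eq reprK.
have FB : zmod_morphism F.
  move=> x y; rewrite -[x]reprK -[y]reprK.
  by rewrite -raddfB !Fpi evB.
have FM : monoid_morphism F.
  split=> [|x y]; first by rewrite [LHS]Fpi evU /h big_nil.
  by rewrite -[x]reprK -[y]reprK -piM !Fpi evM.
exists (HB.pack_for {rmorphism KM m k -> R} F
  (GRing.isZmodMorphism.Build _ _ F FB) (GRing.isMonoidMorphism.Build _ _ F FM)).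
move=> x /mulgrpP[a ->] /=.
by rewrite sym_val Fpi evU /h big_cons big_nil mulr1.
Qed.

(** * Rational functions and their behaviour at infinity *)

Notation ratf k := {fraction {poly k}}.
Notation "p %:F" := (FracField.tofrac p).

Section Ratf.
Variable k : fieldType.
Implicit Types (f g : ratf k) (p q : {poly k}).

Lemma ratf_repr f : f = (\n_(repr f))%:F / (\d_(repr f))%:F.
Proof.
have d0 : (\d_(repr f))%:F != 0 by rewrite tofrac_eq0 denom_ratioP.
apply: (mulIf d0); rewrite mulfVK //.
rewrite -{1}[f]reprK; move: (repr f) => x {d0}; unlock FracField.tofrac.
rewrite -[LHS]FracField.pi_mul; apply/eqmodP.
rewrite /= FracField.equivfE /FracField.mulf !numden_Ratio ?mulr1 ?oner_eq0
  ?denom_ratioP //.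
by rewrite mulrC.
Qed.

Lemma ratfP f : exists p q, q != 0 /\ f = p%:F / q%:F.
Proof. by exists \n_(repr f), \d_(repr f); rewrite denom_ratioP -ratf_repr. Qed.

Lemma ratf_neq0P f : f != 0 -> exists p q, [/\ p != 0, q != 0 & f = p%:F / q%:F].
Proof.
have [p [q [q0 ->]]] := ratfP f => f0; exists p, q; split => //.
by apply: contraNneq f0 => ->; rewrite rmorph0 mul0r.
Qed.

(** The value of f t^(- deg f) at the place at infinity, and minus the valuation
    of f at that place. *)
Definition ratf_lead f : k :=
  lead_coef \n_(repr f) / lead_coef \d_(repr f).
Definition ratf_deg f : int :=
  (size \n_(repr f))%:Z - (size \d_(repr f))%:Z.

Lemma ratf_cross p q f : q != 0 -> f = p%:F / q%:F ->
  \n_(repr f) * q = p * \d_(repr f).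
Proof.
move=> q0 e; apply/eqP; rewrite -tofrac_eq !rmorphM /= -eqr_div ?tofrac_eq0 ?denom_ratioP //.
by rewrite -ratf_repr e.
Qed.

Lemma ratf_leadE p q : q != 0 -> ratf_lead (p%:F / q%:F) = lead_coef p / lead_coef q.
Proof.
move=> q0; rewrite /ratf_lead; set f := p%:F / q%:F.
have /(congr1 lead_coef) := ratf_cross q0 (erefl f); rewrite !lead_coefM => e.
by apply/eqP; rewrite eqr_div ?lead_coef_eq0 ?denom_ratioP // e.
Qed.

Lemma ratf_degE p q : p != 0 -> q != 0 ->
  ratf_deg (p%:F / q%:F) = (size p)%:Z - (size q)%:Z.
Proof.
move=> p0 q0; rewrite /ratf_deg; set f := p%:F / q%:F.
have d0 := denom_ratioP (repr f).
have e := ratf_cross q0 (erefl f).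
have n0 : \n_(repr f) != 0.
  apply: contra_neq p0 => n0; apply: (mulIf d0).
  by rewrite -e n0 !mul0r.
have /(congr1 (fun u : {poly k} => size u)) := e.
rewrite !size_mul // => e'.
rewrite -!size_poly_gt0 in n0 d0 p0 q0.
by move: (size _) (size _) (size _) (size _) n0 d0 p0 q0 e' => *; lia.
Qed.

Lemma ratf_leadM f g : ratf_lead (f * g) = ratf_lead f * ratf_lead g.
Proof.
have [p [q [q0 ->]]] := ratfP f; have [p' [q' [q'0 ->]]] := ratfP g.
rewrite mulf_div -!rmorphM !ratf_leadE ?mulf_neq0 // !lead_coefM.
by rewrite mulf_div.
Qed.

Lemma ratf_degM f g : f != 0 -> g != 0 ->
  ratf_deg (f * g) = ratf_deg f + ratf_deg g.
Proof.
move=> /ratf_neq0P[p [q [p0 q0 ->]]] /ratf_neq0P[p' [q' [p'0 q'0 ->]]].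
rewrite mulf_div -!rmorphM !ratf_degE ?mulf_neq0 // !size_mul //.
rewrite -!size_poly_gt0 in p0 q0 p'0 q'0.
by move: (size _) (size _) (size _) (size _) p0 q0 p'0 q'0 => *; lia.
Qed.

Lemma ratf_lead_neq0 f : f != 0 -> ratf_lead f != 0.
Proof.
move=> /ratf_neq0P[p [q [p0 q0 ->]]].
by rewrite ratf_leadE // mulf_neq0 // ?invr_eq0 lead_coef_eq0.
Qed.

(** The cases of the Steinberg relation at infinity: f or g is congruent to 1,
    both are units, or both have a pole and their leading terms cancel. *)
Lemma ratf_sum1 f g : f != 0 -> g != 0 -> f + g = 1 ->
  [\/ ratf_lead f = 1 /\ ratf_deg f = 0, ratf_lead g = 1 /\ ratf_deg g = 0,
      [/\ ratf_lead f + ratf_lead g = 1, ratf_deg f = 0 & ratf_deg g = 0]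
    | ratf_lead g = - ratf_lead f /\ ratf_deg g = ratf_deg f].
Proof.
move=> /ratf_neq0P[p [q [p0 q0 ->]]] g0 /eqP; rewrite addrC eq_sym -subr_eq => /eqP e.
have qF : q%:F != 0 by rewrite tofrac_eq0.
have {}e : g = (q - p)%:F / q%:F by rewrite rmorphB mulrBl divff.
have r0 : q - p != 0 by apply: contraNneq g0; rewrite e => ->; rewrite rmorph0 mul0r.
have lq0 : lead_coef q != 0 by rewrite lead_coef_eq0.
rewrite e !ratf_leadE // !ratf_degE //; have [lt|gt|eq] := ltngtP (size p) (size q).
- have lt' : (size (- p) < size q)%N by rewrite size_polyN.
  by apply: Or42; rewrite lead_coefDl // size_polyDl // divff // subrr.
- have gt' : (size q < size (- p))%N by rewrite size_polyN.
  apply: Or44; rewrite [q - p]addrC lead_coefDl // size_polyDl // lead_coefN mulNr.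
  by rewrite size_polyN.
have [el|nel] := eqVneq (lead_coef p) (lead_coef q).
  by apply: Or41; rewrite el divff // eq subrr.
have sr : size (q - p) = size q.
  apply/eqP; rewrite eqn_leq (leq_trans (size_polyD _ _)) ?size_polyN ?eq ?maxnn //=.
  rewrite leqNgt; apply/negP => lt.
  have : (q - p)`_(size q).-1 = 0.
    by apply: nth_default; rewrite -ltnS prednK // size_poly_gt0.
  rewrite coefB -{2}eq => /eqP; rewrite subr_eq0 => /eqP e'.
  by move: nel; rewrite /lead_coef e' eqxx.
apply: Or43; rewrite sr eq !subrr; split => //.
rewrite -mulrDl [X in _ + X](_ : _ = lead_coef q - lead_coef p).
  by rewrite addrC subrK divff.
by rewrite /lead_coef sr coefB eq.
Qed.

Lemma ratf_const_subproof : {c : {rmorphism k -> ratf k} | forall a, c a = a%:P%:F}.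
Proof. by exists ((@FracField.tofrac {poly k}) \o (@polyC k) : {rmorphism k -> ratf k}). Qed.

(** Taken from an opaque constant, so that fractions are not unfolded. *)
Definition ratf_const : {rmorphism k -> ratf k} := sval ratf_const_subproof.

Lemma ratf_constE a : ratf_const a = a%:P%:F.
Proof. exact: (svalP ratf_const_subproof). Qed.

Definition ratf_t : ratf k := 'X%:F.

Lemma ratf_t_neq0 : ratf_t != 0.
Proof. by rewrite tofrac_eq0 polyX_eq0. Qed.

Lemma ratf_lead_poly p : ratf_lead p%:F = lead_coef p.
Proof.
rewrite -[p%:F]divr1 -(rmorph1 (@FracField.tofrac _)) ratf_leadE ?oner_eq0 //.
by rewrite lead_coef1 divr1.
Qed.

Lemma ratf_deg_poly p : p != 0 -> ratf_deg p%:F = (size p).-1%:Z.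
Proof.
move=> p0; rewrite -[p%:F]divr1 -(rmorph1 (@FracField.tofrac _)) ratf_degE ?oner_eq0 //.
by rewrite size_poly1; rewrite -size_poly_gt0 in p0; move: (size p) p0 => *; lia.
Qed.

Lemma ratf_lead_const a : ratf_lead (ratf_const a) = a.
Proof. by rewrite ratf_constE ratf_lead_poly lead_coefC. Qed.

Lemma ratf_deg_const a : a != 0 -> ratf_deg (ratf_const a) = 0.
Proof. by move=> a0; rewrite ratf_constE ratf_deg_poly ?polyC_eq0 // size_polyC a0. Qed.

Lemma ratf_deg_t : ratf_deg ratf_t = 1.
Proof. by rewrite ratf_deg_poly ?polyX_eq0 // size_polyX. Qed.

End Ratf.
Arguments ratf_const {k}.
Arguments ratf_t {k}.

(** The substitution t -> c u^n: as c u^n is not constant, a polynomial with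
    leading term a t^d becomes one with leading term f(a) c^d u^(nd). *)
Lemma ratf_subst (k F : fieldType) (f : {rmorphism k -> F}) (c : F) (n : nat) :
    c != 0 -> (0 < n)%N ->
  {h : {rmorphism ratf k -> ratf F} |
    [/\ forall a, h (ratf_const a) = ratf_const (f a),
        h ratf_t = ratf_const c * ratf_t ^+ n
      & forall x, x != 0 ->
          ratf_lead (h x) = f (ratf_lead x) * c ^ ratf_deg x]}.
Proof.
move=> c0 n0.
pose q : {poly F} := c *: 'X^n.
have sq : size q = n.+1 by rewrite size_scale // size_polyXn.
have lq : lead_coef q = c by rewrite lead_coefZ lead_coefXn mulr1.
have [g gE] : {g : {rmorphism {poly k} -> {poly F}} |
    forall p, g p = map_poly f p \Po q}.
  by exists (comp_poly q \o map_poly f : {rmorphism {poly k} -> {poly F}}).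
have sg p : (size (g p)).-1 = ((size p).-1 * n)%N.
  by rewrite gE size_comp_poly sq size_map_poly.
have lg p : lead_coef (g p) = f (lead_coef p) * c ^+ (size p).-1.
  by rewrite gE lead_coef_comp ?sq // lq size_map_poly lead_coef_map.
have g0 p : (g p == 0) = (p == 0).
  by rewrite -!lead_coef_eq0 lg mulf_eq0 fmorph_eq0 (negPf (expf_neq0 _ c0)) orbF.
pose h (x : ratf k) : ratf F := (g \n_(repr x))%:F / (g \d_(repr x))%:F.
have gF p : p != 0 -> (g p)%:F != 0 by rewrite tofrac_eq0 g0.
have hE p r : r != 0 -> h (p%:F / r%:F) = (g p)%:F / (g r)%:F.
  move=> r0; rewrite /h; set x := p%:F / r%:F; apply/eqP.
  rewrite eqr_div ?gF ?denom_ratioP // -!rmorphM tofrac_eq.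
  by rewrite (ratf_cross r0 (erefl x)).
have hB : zmod_morphism h.
  move=> x y; have [p [r [r0 ->]]] := ratfP x; have [p' [r' [r'0 ->]]] := ratfP y.
  rewrite (hE p) // (hE p') //.
  have -> : p%:F / r%:F - p'%:F / r'%:F = (p * r' - p' * r)%:F / (r * r')%:F.
    by rewrite -mulNr addf_div ?tofrac_eq0 // mulNr -!rmorphM -rmorphB.
  rewrite hE ?mulf_neq0 // (rmorphB g) !(rmorphM g) /= rmorphB !rmorphM /=.
  by rewrite -[in RHS]mulNr addf_div ?gF // mulNr.
have hM : monoid_morphism h.
  split=> [|x y].
    by rewrite -[1]divr1 -(rmorph1 (@FracField.tofrac _)) hE ?oner_eq0 // !rmorph1 divr1.
  have [p [r [r0 ->]]] := ratfP x; have [p' [r' [r'0 ->]]] := ratfP y.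
  by rewrite mulf_div -!rmorphM !hE ?mulf_neq0 // mulf_div -!rmorphM.
have hp p : h p%:F = (g p)%:F.
  by rewrite -[p%:F]divr1 -(rmorph1 (@FracField.tofrac _)) hE ?oner_eq0 // !rmorph1 divr1.
exists (HB.pack_for {rmorphism ratf k -> ratf F} h
  (GRing.isZmodMorphism.Build _ _ h hB) (GRing.isMonoidMorphism.Build _ _ h hM)).
split=> [a||x /ratf_neq0P[p [r [p0 r0 ->]]]] /=.
- by rewrite !ratf_constE hp gE map_polyC comp_polyC.
- by rewrite hp gE map_polyX comp_polyX ratf_constE -rmorphXn -rmorphM mul_polyC.
rewrite hE // !ratf_leadE ?g0 // ratf_degE // !lg rmorphM fmorphV invfM mulrACA.
congr (_ * _).
rewrite -!size_poly_gt0 in p0 r0.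
have -> : (size p)%:Z - (size r)%:Z = (size p).-1%:Z - (size r).-1%:Z.
  by move: (size p) (size r) p0 r0 => *; lia.
by rewrite expfzDr // -invr_expz.
Qed.

(** * Specialisation and residue at infinity *)

HB.lock Definition utmx (R : pzRingType) (a b d : R) : 'M[R]_2 :=
  \matrix_(i, j) if i == 0 then (if j == 0 then a else b)
                 else (if j == 0 then 0 else d).

Section UpperTriangular.
Variable R : pzRingType.

Lemma utmxE (a b d : R) i j : utmx a b d i j =
  if i == 0 then (if j == 0 then a else b) else (if j == 0 then 0 else d).
Proof. by rewrite utmx.unlock mxE. Qed.

Lemma utmxD (a b d a' b' d' : R) :
  utmx a b d + utmx a' b' d' = utmx (a + a') (b + b') (d + d').
Proof.
apply/matrixP => i j; rewrite ?(mxE, utmxE).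
by case: (i == 0); case: (j == 0); rewrite ?addr0.
Qed.

Lemma utmxN (a b d : R) : - utmx a b d = utmx (- a) (- b) (- d).
Proof.
apply/matrixP => i j; rewrite ?(mxE, utmxE).
by case: (i == 0); case: (j == 0); rewrite ?oppr0.
Qed.

Lemma utmx0 : utmx 0 0 0 = 0 :> 'M[R]_2.
Proof.
by apply/matrixP => i j; rewrite ?(mxE, utmxE); case: (i == 0); case: (j == 0).
Qed.

Lemma utmx1 : utmx 1 0 1 = 1 :> 'M[R]_2.
Proof.
apply/matrixP => i j; rewrite ?(mxE, utmxE).
by case: i j => [[|[|i]] hi] [[|[|j]] hj].
Qed.

Lemma utmxM (a b d a' b' d' : R) :
  utmx a b d * utmx a' b' d' = utmx (a * a') (a * b' + b * d') (d * d').
Proof.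
rewrite -mulmxE; apply/matrixP => i j.
rewrite ?(mxE, utmxE) !big_ord_recl big_ord0 ?(mxE, utmxE) /= addr0.
by case: (i == 0); case: (j == 0); rewrite ?mulr0 ?mul0r ?addr0 ?add0r.
Qed.

Lemma mxMn (A : 'M[R]_2) n i j : (A *+ n) i j = A i j *+ n.
Proof. by elim: n => [|n IHn]; rewrite ?mulr0n ?mxE // !mulrS mxE IHn. Qed.

Lemma mx2B (A B : 'M[R]_2) i j : (A - B) i j = A i j - B i j.
Proof. by rewrite !mxE. Qed.

Lemma mx2_utmx (A : 'M[R]_2) : A 1 0 = 0 -> A = utmx (A 0 0) (A 0 1) (A 1 1).
Proof.
move=> A10; apply/matrixP => i j; rewrite utmxE.
by case: i j => [[|[|i]] hi] [[|[|j]] hj] //=; rewrite -?A10;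
  congr (A _ _); apply: val_inj.
Qed.

End UpperTriangular.

Section Residue.
Variables (m : nat) (m_odd : odd m) (k : fieldType).
Local Notation KE := (KM m (ratf k)).
Local Notation K := (KM m k).

(** At infinity {f} has specialisation {lead f} and, up to the sign of the
    uniformiser t^-1, residue deg f. The residue is a derivation twisted by the
    sign of the grading, so both are recorded by a ring morphism to upper
    triangular matrices, to be checked on the presentation of the Milnor
    K-ring. *)
Lemma place_morphism : {rho : {rmorphism KE -> 'M[K]_2} |
  forall x, x != 0 -> rho (sym m x) =
    utmx (sym m (ratf_lead x)) (1 *~ ratf_deg x) (- sym m (ratf_lead x))}.
Proof.
apply: KM_lift => [x y x0 y0|x y x0 y0|x y x0 y0 xy|A].
- rewrite ratf_leadM (ratf_degM x0 y0) utmxD.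
  rewrite (symM m (ratf_lead_neq0 x0) (ratf_lead_neq0 y0)).
  by rewrite mulrzDr opprD.
- rewrite !utmxM utmxN !mulrzAr !mulrzAl !mulr1 !mul1r !mulrNN.
  move: (sym_anti m_odd (ratf_lead x) (ratf_lead y)).
  move: (sym _ (ratf_lead x)) (sym _ (ratf_lead y)) => a b ->.
  by rewrite !mulNrz opprD opprK addrC.
- rewrite utmxM !mulrzAr !mulrzAl !mulr1 !mul1r mulrNN mulNrz.
  case: (ratf_sum1 x0 y0 xy) => [[-> ->]|[-> ->]|[e -> ->]|[-> ->]].
  + by rewrite sym1 mul0r mulr0z mul0rz subrr utmx0.
  + by rewrite sym1 mulr0 mulr0z mul0rz subrr utmx0.
  + by rewrite (sym_steinberg m e) !mulr0z subrr utmx0.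
  by rewrite (symN m_odd) (sym_sqr m_odd) subrr utmx0.
by apply/matrixP => i j; rewrite mxMn KM_mulrn mxE.
Qed.

Let rho := sval place_morphism.

Let rho_sym x : x != 0 -> rho (sym m x) =
  utmx (sym m (ratf_lead x)) (1 *~ ratf_deg x) (- sym m (ratf_lead x)).
Proof. exact: (svalP place_morphism). Qed.

Definition spec (x : KE) : K := rho x 0 0.
Definition res (x : KE) : K := rho x 0 1.
(** The specialisation, with the sign (-1)^n in degree n. *)
Definition twist (x : KE) : K := rho x 1 1.

Let rhoE x : rho x = utmx (spec x) (res x) (twist x).
Proof.
rewrite /spec /res /twist; apply: mx2_utmx.
elim/KM_ind: x => [x y hx hy|w].
  by rewrite raddfB /= mx2B hx hy subrr.
elim: w => [|g w IHw]; first by rewrite big_nil rmorph1 -utmx1 utmxE.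
by rewrite big_cons rmorphM /= (rho_sym (valP g)) (mx2_utmx IHw) utmxM utmxE.
Qed.

Let specE x a b d : rho x = utmx a b d -> spec x = a /\ res x = b.
Proof. by move=> e; rewrite /spec /res e !utmxE. Qed.

Let twistE x a b d : rho x = utmx a b d -> twist x = d.
Proof. by move=> e; rewrite /twist e !utmxE. Qed.

Lemma specB x y : spec (x - y) = spec x - spec y.
Proof. by rewrite /spec raddfB /= mx2B. Qed.

Lemma resB x y : res (x - y) = res x - res y.
Proof. by rewrite /res raddfB /= mx2B. Qed.

Let twistB x y : twist (x - y) = twist x - twist y.
Proof. by rewrite /twist raddfB /= mx2B. Qed.

Let rhoM x y : rho (x * y) = utmx (spec x * spec y)
  (spec x * res y + res x * twist y) (twist x * twist y).
Proof. by rewrite rmorphM /= (rhoE x) (rhoE y) utmxM. Qed.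

Lemma specM x y : spec (x * y) = spec x * spec y.
Proof. by have [] := specE (rhoM x y). Qed.

Lemma resM x y : res (x * y) = spec x * res y + res x * twist y.
Proof. by have [] := specE (rhoM x y). Qed.

Let twistM x y : twist (x * y) = twist x * twist y.
Proof. exact: twistE (rhoM x y). Qed.

Let rho1 : rho 1 = utmx 1 0 1.
Proof. by rewrite rmorph1 utmx1. Qed.

Lemma spec1 : spec 1 = 1. Proof. by have [] := specE rho1. Qed.
Lemma res1 : res 1 = 0. Proof. by have [] := specE rho1. Qed.
Let twist1 : twist 1 = 1. Proof. exact: twistE rho1. Qed.

Lemma spec_sym x : x != 0 -> spec (sym m x) = sym m (ratf_lead x).
Proof. by move=> /rho_sym /specE[]. Qed.

Lemma res_sym x : x != 0 -> res (sym m x) = 1 *~ ratf_deg x.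
Proof. by move=> /rho_sym /specE[]. Qed.

Let twist_sym x : x != 0 -> twist (sym m x) = - sym m (ratf_lead x).
Proof. by move=> /rho_sym /twistE. Qed.

Lemma spec_const x : spec (kmap ratf_const x) = x.
Proof.
elim/KM_ind: x => [x y hx hy|w]; first by rewrite kmapB specB hx hy.
rewrite kmap_word; elim: w => [|a w IHw]; first by rewrite !big_nil spec1.
by rewrite !big_cons specM IHw spec_sym ?fmorph_eq0 ?(valP a) // ratf_lead_const.
Qed.

Let res_const x : res (kmap ratf_const x) = 0.
Proof.
elim/KM_ind: x => [x y hx hy|w]; first by rewrite kmapB resB hx hy subr0.
rewrite kmap_word; elim: w => [|a w IHw]; first by rewrite !big_nil res1.
rewrite !big_cons resM IHw mulr0 add0r res_sym ?fmorph_eq0 ?(valP a) //.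
by rewrite ratf_deg_const ?(valP a) // mulr0z mul0r.
Qed.

Lemma res_constMt x : res (kmap ratf_const x * sym m ratf_t) = x.
Proof.
rewrite resM res_const mul0r addr0 spec_const res_sym ?ratf_t_neq0 //.
by rewrite ratf_deg_t mulr1.
Qed.

Lemma twist_comm (F : fieldType) (f : {rmorphism k -> F}) (c : F) x :
  sym m c * kmap f (spec x) = kmap f (twist x) * sym m c.
Proof.
elim/KM_ind: x => [x y hx hy|w].
  by rewrite specB twistB !kmapB mulrBr mulrBl hx hy.
elim: w => [|a w IHw]; first by rewrite big_nil spec1 twist1 kmap1 mul1r mulr1.
rewrite big_cons specM twistM (spec_sym (valP a)) (twist_sym (valP a)).
rewrite !kmapM kmap_sym kmapN kmap_sym.
exact: (anti_cons (sym_anti m_odd c (f (ratf_lead (val a)))) IHw).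
Qed.

Lemma res_part (D : pred nat) x :
  x \in @KM_part m (ratf k) D -> res x \in @KM_part m k (fun j => D j.+1).
Proof.
move=> hx; elim/KM_part_ind: x / hx => [|x y hx hy|w Dw].
- by rewrite -(subrr 0) resB subrr rpred0.
- by rewrite resB rpredB.
have [_] : twist (\prod_(a <- w) sym m (val a)) \in @KM_part m k (pred1 (size w)) /\
    res (\prod_(a <- w) sym m (val a)) \in @KM_part m k (fun j => j.+1 == size w).
  elim: w {Dw} => [|a w [IHt IHr]].
    rewrite big_nil twist1 res1 rpred0; split=> //.
    exact: one_part.
  rewrite big_cons twistM resM (twist_sym (valP a)) (res_sym (valP a)) (spec_sym (valP a)).
  have sa := sym_part m (ratf_lead (val a)).
  split.
    have dec i j : pred1 1%N i -> pred1 (size w) j -> pred1 (size w).+1 (i + j)%N.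
      by move=> /eqP-> /eqP->; rewrite /= add1n.
    apply: KM_partM dec _ IHt; exact: rpredNr sa.
  apply: rpredD.
    have dec i j : pred1 1%N i -> j.+1 == size w -> (i + j).+1 == (size w).+1.
      by move=> /eqP->; rewrite add1n eqSS.
    exact: KM_partM dec sa IHr.
  by rewrite mulrzAl mul1r rpredMz //; apply: KM_partS IHt => j /eqP->.
by apply: KM_partS => j /eqP->.
Qed.

End Residue.

Section Substitution.
Variables (m : nat) (m_odd : odd m).
Local Notation spec := (spec m_odd).
Local Notation res := (res m_odd).

(** On a symbol {g} of length one this says {a c^d} = {a} + d {c}, with a and d
    the leading coefficient and the degree of g. The general case follows since
    {c} commutes with the specialisation up to the sign in twist, and since
    {c} y {c} = 0 for all y. *)
Lemma spec_subst (k F : fieldType) (f : {rmorphism k -> F}) (c : F)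
    (h : {rmorphism ratf k -> ratf F}) : c != 0 ->
    (forall x, x != 0 -> ratf_lead (h x) = f (ratf_lead x) * c ^ ratf_deg x) ->
  forall x : KM m (ratf k),
    spec (kmap h x) = kmap f (spec x) + kmap f (res x) * sym m c.
Proof.
move=> c0 lead_h; elim/KM_ind => [x y hx hy|w].
  rewrite kmapB (specB m_odd (kmap h x)) hx hy specB resB !kmapB mulrBl.
  by rewrite opprD addrACA.
elim: w => [|a w].
  by rewrite big_nil kmap1 spec1 kmap1 res1 kmap0 mul0r addr0 spec1.
rewrite big_cons; move: (\prod_(b <- w) _) => x IHx.
have ha0 : h (val a) != 0 by rewrite fmorph_eq0 (valP a).
have la0 := ratf_lead_neq0 (valP a).
rewrite [kmap h _]kmapM [LHS]specM IHx kmap_sym (spec_sym m_odd ha0) (lead_h _ (valP a)).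
rewrite symM ?expfz_neq0 ?fmorph_eq0 // symXz // specM resM.
rewrite (spec_sym m_odd (valP a)) (res_sym m_odd (valP a)) mulrzAl mul1r.
rewrite kmapM kmapD kmapM kmap_sym kmapMz.
have e1 := twist_comm m_odd f c x.
have e2 := sym_sandwich m_odd c (kmap f (res x)).
move: (sym m (f _)) (sym m c) (kmap f (res x)) (kmap f (spec x))
  (kmap f (twist _ x)) (ratf_deg _) e1 e2 => l s B A T d e1 e2.
rewrite mulrDl !mulrDr !mulrzAl mulrDl mulrzAl -e1 [s * (B * s)]mulrA e2.
by rewrite mul0rz addr0 -!addrA !mulrA.
Qed.

End Substitution.

(** * Natural functions of units *)

Section Families.
Variables (m : nat) (m_odd : odd m).

Lemma KM_part0 (k : fieldType) (x : KM m k) : x \in KM_part pred0 -> x = 0.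
Proof.
move=> hx; elim/KM_part_ind: x / hx => // x y -> ->; exact: subr0.
Qed.

(** Independent variables detect coefficients: multiplication by the symbol of
    a transcendental is undone by the residue. *)
Lemma coef_part (N : nat) : forall (D : pred nat) (k0 : fieldType) (b : KM m k0),
    (forall (k : fieldType) (f : {rmorphism k0 -> k}) (w : words k), size w = N ->
       kmap f b * \prod_(a <- w) sym m (val a) \in KM_part D) ->
  b \in KM_part (fun j => D (j + N)%N).
Proof.
elim: N => [|N IHN] D k0 b hb.
  have := hb k0 (idfun : {rmorphism k0 -> k0}) [::] erefl.
  rewrite big_nil mulr1 kmap_id // => /KM_partS; apply => j.
  by rewrite addn0.
pose b' : KM m (ratf k0) := kmap ratf_const b * sym m ratf_t.
have {}/IHN hb' : forall (k : fieldType) (f : {rmorphism ratf k0 -> k}) (w : words k),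
    size w = N -> kmap f b' * \prod_(a <- w) sym m (val a) \in KM_part D.
  move=> k f w sw.
  have ft0 : f ratf_t != 0 by rewrite fmorph_eq0 ratf_t_neq0.
  have [c ec] := mulgrpP ft0.
  have := hb k (f \o ratf_const : {rmorphism k0 -> k}) (c :: w).
  rewrite big_cons -ec /= sw => /(_ erefl).
  by rewrite /b' kmapM kmap_sym (kmap_comp (g := f \o ratf_const)) // mulrA.
have := res_part m_odd hb'; rewrite res_constMt.
by move=> /KM_partS; apply => j; rewrite addSnnS.
Qed.

Lemma coef_eq0 (N : nat) (k0 : fieldType) (b : KM m k0) :
    (forall (k : fieldType) (f : {rmorphism k0 -> k}) (w : words k), size w = N ->
       kmap f b * \prod_(a <- w) sym m (val a) = 0) ->
  b = 0.
Proof.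
move=> hb; apply: KM_part0; apply: (@coef_part N pred0) => k f w sw.
by rewrite hb // rpred0.
Qed.

Lemma coef_inj (N : nat) (k0 : fieldType) (b c : KM m k0) :
    (forall (k : fieldType) (f : {rmorphism k0 -> k}) (w : words k), size w = N ->
      kmap f b * \prod_(a <- w) sym m (val a) =
      kmap f c * \prod_(a <- w) sym m (val a)) ->
  b = c.
Proof.
move=> bc; apply/eqP; rewrite -subr_eq0; apply/eqP/(@coef_eq0 N) => k f w sw.
by rewrite kmapB mulrBl bc // subrr.
Qed.

Section OneVariable.
Variables (k0 : fieldType)
  (Psi : forall k : fieldType, {rmorphism k0 -> k} -> mulgrp k -> KM m k).
Hypothesis Psi_nat : forall (k l : fieldType) (f : {rmorphism k0 -> k})
    (g : {rmorphism k0 -> l}) (h : {rmorphism k -> l}),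
  (forall a, h (f a) = g a) ->
  forall a, kmap h (Psi f a) = Psi g (mulgrp_map h a).
Hypothesis Psi_Xm : forall (k : fieldType) (f : {rmorphism k0 -> k})
  (a b : mulgrp k) (c : k), val b = val a * c ^+ m -> Psi f b = Psi f a.
Hypothesis Psi1 : forall (k : fieldType) (f : {rmorphism k0 -> k})
  (a : mulgrp k), val a = 1 -> Psi f a = 0.

(** The value x at the generic point t determines Psi at any unit a, through
    the substitution t -> a u^m: the units a u^m and a have the same image, and
    specialising x(a u^m) at u = infinity leaves spec x + res x {a}. *)
Lemma natural_one_variable : exists b : KM m k0,
  forall (k : fieldType) (f : {rmorphism k0 -> k}) (a : mulgrp k),
    Psi f a = kmap f b * sym m (val a).
Proof.
have m_gt0 : (0 < m)%N by case: (m) m_odd.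
have [T eT] := mulgrpP (ratf_t_neq0 k0).
pose x := Psi ratf_const T.
have PsiE (k : fieldType) (f : {rmorphism k0 -> k}) (a : mulgrp k) :
    Psi f a = kmap f (spec m_odd x) + kmap f (res m_odd x) * sym m (val a).
  have [h [h_const h_t h_lead]] := ratf_subst f (valP a) m_gt0.
  rewrite -(spec_subst m_odd (valP a) h_lead).
  rewrite (Psi_nat (g := ratf_const \o f)) //.
  rewrite (@Psi_Xm _ _ (mulgrp_map ratf_const a) _ ratf_t); last first.
    by rewrite /= -eT h_t.
  by rewrite -(Psi_nat (f := f)) // spec_const.
exists (res m_odd x) => k f a; rewrite PsiE.
have [e ee] := mulgrpP (oner_neq0 k).
have := PsiE k f e; rewrite Psi1 -?ee // sym1 mulr0 addr0 => <-.
by rewrite add0r.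
Qed.

End OneVariable.

(** Several variables: fix the first one, and observe that the coefficient of
    the others is a natural function of it. *)
Lemma natural_multilinear (N : nat) : forall (k0 : fieldType)
    (Psi : forall k : fieldType, {rmorphism k0 -> k} -> words k -> KM m k),
    (forall (k l : fieldType) (f : {rmorphism k0 -> k})
        (g : {rmorphism k0 -> l}) (h : {rmorphism k -> l}),
      (forall a, h (f a) = g a) -> forall w, size w = N ->
      kmap h (Psi k f w) = Psi l g (map (mulgrp_map h) w)) ->
    (forall (k : fieldType) (f : {rmorphism k0 -> k}) (u v : words k)
        (a b : mulgrp k) (c : k), size (u ++ a :: v) = N ->
      val b = val a * c ^+ m -> Psi k f (u ++ b :: v) = Psi k f (u ++ a :: v)) ->
    (forall (k : fieldType) (f : {rmorphism k0 -> k}) (u v : words k)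
        (a : mulgrp k), size (u ++ a :: v) = N ->
      val a = 1 -> Psi k f (u ++ a :: v) = 0) ->
  exists b : KM m k0,
    forall (k : fieldType) (f : {rmorphism k0 -> k}) (w : words k), size w = N ->
      Psi k f w = kmap f b * \prod_(a <- w) sym m (val a).
Proof.
elim: N => [|N IHN] k0 Psi Psi_nat Psi_Xm Psi1.
  exists (Psi k0 (idfun : {rmorphism k0 -> k0}) [::]) => k f [|//] _.
  by rewrite big_nil mulr1 (Psi_nat _ _ _ f).
have Psi_ext (k : fieldType) (f g : {rmorphism k0 -> k}) w :
    (forall a, f a = g a) -> size w = N.+1 -> Psi k f w = Psi k g w.
  move=> fg sw; rewrite -[LHS](@kmap_id m k (idfun : {rmorphism k -> k})) //.
  rewrite (Psi_nat _ _ _ g) //; congr (Psi _ _ _); rewrite -[RHS]map_id.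
  by apply: eq_map => a; apply: val_inj.
have ex_coef (k : fieldType) (f : {rmorphism k0 -> k}) (a : mulgrp k) :
    {b : KM m k | forall (l : fieldType) (g : {rmorphism k -> l}) (w : words l),
      size w = N -> Psi l (g \o f : {rmorphism k0 -> l}) (mulgrp_map g a :: w) =
        kmap g b * \prod_(c <- w) sym m (val c)}.
  apply: cid; apply: (IHN k (fun l g w => Psi l (g \o f : {rmorphism k0 -> l})
    (mulgrp_map g a :: w))).
  - move=> l l' g g' h hg w sw.
    rewrite (Psi_nat _ _ _ (g' \o f : {rmorphism k0 -> l'})) /= ?sw //.
    congr (Psi _ _ (_ :: _)); by apply: val_inj; rewrite /= hg.
  - move=> l g u v c d e suv; apply: (Psi_Xm l _ (mulgrp_map g a :: u)).
    by rewrite /= suv.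
  move=> l g u v c suv; apply: (Psi1 l _ (mulgrp_map g a :: u)).
  by rewrite /= suv.
pose B k f a : KM m k := sval (ex_coef k f a).
have BE k f a := svalP (ex_coef k f a).
have [b hb] : exists b : KM m k0,
    forall (k : fieldType) (f : {rmorphism k0 -> k}) (a : mulgrp k),
      B k f a = kmap f b * sym m (val a).
  apply: natural_one_variable => [k l f g h hfg a|k f a b c e|k f a a1].
  - apply: (@coef_inj N) => l' h' w sw.
    rewrite (kmap_comp (g := h' \o h)) // -!BE //.
    rewrite (Psi_ext _ _ (h' \o g : {rmorphism k0 -> l'})) /= ?sw //; last first.
      by move=> c; rewrite /= hfg.
    by congr (Psi _ _ (_ :: _)); apply: val_inj.
  - apply: (@coef_inj N) => l' h' w sw; rewrite -!BE //.
    by apply: (Psi_Xm l' _ [::] w _ _ (h' c)); rewrite /= ?sw // e rmorphM rmorphXn.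
  apply: (@coef_inj N) => l' h' w sw; rewrite kmap0 mul0r -BE //.
  by apply: (Psi1 l' _ [::]); rewrite /= ?sw // a1 rmorph1.
exists b => k f [//|a w] [sw]; rewrite big_cons mulrA -hb.
have := BE k f a k (idfun : {rmorphism k -> k}) w sw.
rewrite [kmap idfun _]kmap_id // => <-.
rewrite (Psi_ext _ _ f) /= ?sw //.
by congr (Psi _ _ (_ :: _)); apply: val_inj.
Qed.

End Families.

(** * Derivatives of operations *)

Notation wsym m w := (\prod_(a <- w) sym m (val a)).

(** The class of x in K_i(k)/m, with default value 0 outside degree i. *)
Definition homog (m i : nat) (k : fieldType) (x : KM m k) : KMdeg m i k :=
  insubd (0 : KMdeg m i k) x.

Section Homogeneous.
Variables (m i : nat).

Lemma val_homog (k : fieldType) (x : KM m k) :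
  x \in KM_part (pred1 i) -> val (homog i x) = x.
Proof. exact: insubdK. Qed.

Lemma homog0 (k : fieldType) : homog i 0 = 0 :> KMdeg m i k.
Proof. by apply: val_inj; rewrite val_homog ?rpred0 ?raddf0. Qed.

Lemma val_homog_word (k : fieldType) (w : words k) :
  size w = i -> val (homog i (wsym m w)) = wsym m w.
Proof. by move=> sw; rewrite val_homog // word_part //= sw. Qed.

Lemma val_symbol (k : fieldType) (t : i.-tuple (mulgrp k)) :
  val (symbol m t) = wsym m t.
Proof. exact: pi_word. Qed.

Lemma val_KMdeg_map (k l : fieldType) (f : {rmorphism k -> l}) (x : KMdeg m i k) :
  val (KMdeg_map f x) = kmap f (val x).
Proof. by rewrite -kmapE. Qed.

Lemma KMdegB (k : fieldType) (x y : KMdeg m i k) : val (x - y) = val x - val y.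
Proof. exact: raddfB. Qed.

Lemma KMdegD (k : fieldType) (x y : KMdeg m i k) : val (x + y) = val x + val y.
Proof. exact: raddfD. Qed.

Lemma KMdegN (k : fieldType) (x : KMdeg m i k) : val (- x) = - val x.
Proof. exact: raddfN. Qed.

Lemma KMdegMn (k : fieldType) (x : KMdeg m i k) n : val (x *+ n) = val x *+ n.
Proof. exact: raddfMn. Qed.

Lemma KMdeg_sum (k : fieldType) (I : Type) (r : seq I) (F : I -> KMdeg m i k) :
  val (\sum_(j <- r) F j) = \sum_(j <- r) val (F j).
Proof. by apply: (big_morph val (@KMdegD k)); rewrite raddf0. Qed.

Lemma KMdeg_mapD (k l : fieldType) (f : {rmorphism k -> l}) (x y : KMdeg m i k) :
  KMdeg_map f (x + y) = KMdeg_map f x + KMdeg_map f y.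
Proof.
by apply: val_inj; rewrite KMdegD !val_KMdeg_map KMdegD kmapD.
Qed.

Lemma KMdeg_map0 (k l : fieldType) (f : {rmorphism k -> l}) :
  KMdeg_map f (0 : KMdeg m i k) = 0.
Proof. by apply: val_inj; rewrite val_KMdeg_map raddf0 kmap0. Qed.

Lemma KMdeg_map_id (k : fieldType) (f : {rmorphism k -> k}) (x : KMdeg m i k) :
  (forall a, f a = a) -> KMdeg_map f x = x.
Proof. by move=> fid; apply: val_inj; rewrite val_KMdeg_map kmap_id. Qed.

Lemma KMdeg_map_comp (j k l : fieldType) (f : {rmorphism j -> k})
    (g : {rmorphism j -> l}) (h : {rmorphism k -> l}) (x : KMdeg m i j) :
  (forall a, h (f a) = g a) -> KMdeg_map h (KMdeg_map f x) = KMdeg_map g x.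
Proof. by move=> e; apply: val_inj; rewrite !val_KMdeg_map (kmap_comp _ e). Qed.

Lemma KMdeg_map_word (k l : fieldType) (f : {rmorphism k -> l}) (w : words k) :
  size w = i ->
  KMdeg_map f (homog i (wsym m w)) = homog i (wsym m (map (mulgrp_map f) w)).
Proof.
move=> sw; apply: val_inj; rewrite val_KMdeg_map !val_homog_word ?size_map //.
by rewrite kmap_word big_map.
Qed.

Lemma KMdeg_ind (k : fieldType) (P : KMdeg m i k -> Prop) :
    (P 0) -> (forall x y, P x -> P y -> P (x - y)) ->
    (forall w : words k, size w = i -> P (homog i (wsym m w))) ->
  forall x, P x.
Proof.
move=> P0 PB Pw x.
suff: P (homog i (val x)) by rewrite /homog valKd.
suff [_ //] : val x \in @KM_part m k (pred1 i) /\ P (homog i (val x)).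
have hx := valP x; elim/KM_part_ind: (val x) / hx => [|y z [hy Py] [hz Pz]|w /eqP sw].
- by rewrite rpred0 homog0.
- rewrite rpredB //; split=> //; rewrite (_ : homog i (y - z) = homog i y - homog i z).
    exact: PB.
  by apply: val_inj; rewrite KMdegB !val_homog // rpredB.
by rewrite word_part ?sw //=; split=> //; apply: Pw.
Qed.

End Homogeneous.

Section Derivative.
Variables (m i : nat) (m_odd : odd m) (k0 : fieldType).
Local Notation op := (operation m i k0).
Implicit Types phi psi : op.

Lemma op_nat phi (k l : fieldType) (f : {rmorphism k0 -> k})
    (g : {rmorphism k0 -> l}) (h : {rmorphism k -> l}) x :
  (forall a, h (f a) = g a) ->
  kmap h (phi k f x) = phi l g (KMdeg_map h x).
Proof. by move=> e; rewrite -kmapE; apply: op_natural. Qed.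

Lemma op_eqmor phi (k : fieldType) (f g : {rmorphism k0 -> k}) x :
  (forall a, f a = g a) -> phi k f x = phi k g x.
Proof.
move=> fg; rewrite -[LHS](@kmap_id m k (idfun : {rmorphism k -> k})) //.
by rewrite (op_nat phi (g := g)) // KMdeg_map_id.
Qed.

(** For x over k, s |-> phi(x + s) - phi(x) is a natural function of the
    entries of the symbol s over the extensions of k. *)
Lemma difference_coef phi (k : fieldType) (f : {rmorphism k0 -> k})
    (x : KMdeg m i k) :
  {b : KM m k | forall (l : fieldType) (g : {rmorphism k -> l})
     (f' : {rmorphism k0 -> l}) (w : words l),
     (forall a, g (f a) = f' a) -> size w = i ->
     kmap g b * wsym m w =
       phi l f' (KMdeg_map g x + homog i (wsym m w)) - phi l f' (KMdeg_map g x)}.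
Proof.
apply: cid.
pose Psi (l : fieldType) (g : {rmorphism k -> l}) (w : words l) : KM m l :=
  phi l (g \o f : {rmorphism k0 -> l}) (KMdeg_map g x + homog i (wsym m w)) -
  phi l (g \o f : {rmorphism k0 -> l}) (KMdeg_map g x).
have [|||b hb] := @natural_multilinear m m_odd i k Psi.
- move=> l l' g g' h hg w sw; rewrite /Psi kmapB.
  rewrite !(op_nat phi (g := g' \o f)) ?KMdeg_mapD ?KMdeg_map_word //;
    try by move=> a /=; rewrite hg.
  by rewrite (KMdeg_map_comp _ hg).
- move=> l g u v a b c suv e; rewrite /Psi.
  suff -> : wsym m (u ++ b :: v) = wsym m (u ++ a :: v) by [].
  have c0 : c != 0.
    have := valP b; rewrite e mulf_eq0 negb_or => /andP[_].
    by rewrite expf_eq0 negb_and; case: (m) m_odd.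
  by rewrite !big_cat !big_cons /= e sym_mulXm.
- move=> l g u v a suv a1; rewrite /Psi.
  suff -> : homog i (wsym m (u ++ a :: v)) = 0 by rewrite addr0 subrr.
  by rewrite big_cat big_cons /= a1 sym1 mul0r mulr0 homog0.
exists b => l g f' w gf sw; rewrite -hb // /Psi.
have e y : phi l (g \o f : {rmorphism k0 -> l}) y = phi l f' y.
  exact: (op_eqmor phi y (f := (g \o f : {rmorphism k0 -> l}))).
by rewrite !e.
Qed.

Lemma op_deriv_natural phi (k l : fieldType) (f : {rmorphism k0 -> k})
    (g : {rmorphism k0 -> l}) (h : {rmorphism k -> l}) :
  (forall a, h (f a) = g a) -> forall x : KMdeg m i k,
  KM_map h (sval (difference_coef phi f x)) =
    sval (difference_coef phi g (KMdeg_map h x)).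
Proof.
move=> hfg x; rewrite kmapE; apply: (@coef_inj m m_odd i) => l' g' w sw.
have := svalP (difference_coef phi f x) l' (g' \o h : {rmorphism k -> l'})
  (g' \o g : {rmorphism k0 -> l'}) w.
have := svalP (difference_coef phi g (KMdeg_map h x)) l' g'
  (g' \o g : {rmorphism k0 -> l'}) w.
move: (sval _) (sval _) => c b hc hb.
rewrite (kmap_comp (g := g' \o h : {rmorphism k -> l'})) // hb //; last first.
  by move=> a /=; rewrite hfg.
rewrite hc // (KMdeg_map_comp (g := g' \o h : {rmorphism k -> l'})) //.
Qed.

(** Natural because the coefficient of a multiple of all symbols is unique. *)
Definition op_deriv phi : op := Operation (op_deriv_natural phi).

Lemma op_derivE phi (k : fieldType) (f : {rmorphism k0 -> k}) (x : KMdeg m i k)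
    (w : words k) : size w = i ->
  phi k f (x + homog i (wsym m w)) = phi k f x + op_deriv phi k f x * wsym m w.
Proof.
move=> sw.
have := svalP (difference_coef phi f x) k (idfun : {rmorphism k -> k}) f w.
rewrite kmap_id // KMdeg_map_id // => -> //.
by rewrite [RHS]addrC subrK.
Qed.

Lemma op_deriv_part phi (D : pred nat) :
    (forall (k : fieldType) (f : {rmorphism k0 -> k}) x, phi k f x \in KM_part D) ->
  forall (k : fieldType) (f : {rmorphism k0 -> k}) x,
    op_deriv phi k f x \in KM_part (fun j => D (j + i)%N).
Proof.
move=> hD k f x; apply: coef_part => // l g w sw.
rewrite kmap.unlock (op_natural (op_deriv phi) (g := g \o f : {rmorphism k0 -> l})) //.
have e := op_derivE phi (g \o f : {rmorphism k0 -> l}) (KMdeg_map g x) sw.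
rewrite (_ : _ * _ = phi l (g \o f : {rmorphism k0 -> l})
    (KMdeg_map g x + homog i (wsym m w)) -
  phi l (g \o f : {rmorphism k0 -> l}) (KMdeg_map g x)).
  by apply: rpredB; apply: hD.
by rewrite e [X in X - _]addrC addrK.
Qed.

End Derivative.

(** * Linear combinations of operations, and symbols of odd degree *)

Lemma op_lincombE (m i : nat) (k0 : fieldType) (I : Type)
    (b : I -> operation m i k0) (s : seq I) (a : I -> KM m k0)
    (k : fieldType) (f : {rmorphism k0 -> k}) (x : KMdeg m i k) :
  op_lincomb b s a k f x = \sum_(n <- s) kmap f (a n) * b n k f x.
Proof.
elim: s => [|n s IHs]; rewrite /op_lincomb ?big_nil // !big_cons /=.
by rewrite kmapE -IHs.
Qed.

Lemma op_lincomb_uniq (m i : nat) (k0 : fieldType) (I : finType)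
    (b : I -> operation m i k0) (s : seq I) (a : I -> KM m k0)
    (k : fieldType) (f : {rmorphism k0 -> k}) (x : KMdeg m i k) : uniq s ->
  op_lincomb b s a k f x =
    \sum_n kmap f (if n \in s then a n else 0) * b n k f x.
Proof.
move=> us; rewrite op_lincombE big_uniq //= big_mkcond; apply: eq_bigr => n _.
by case: ifP; rewrite ?kmap0 ?mul0r.
Qed.

Lemma op_at0 (m i : nat) (k0 : fieldType) (phi : operation m i k0)
    (k : fieldType) (f : {rmorphism k0 -> k}) :
  phi k f 0 = kmap f (phi k0 (idfun : {rmorphism k0 -> k0}) 0).
Proof. by rewrite (op_nat phi (g := f)) // KMdeg_map0. Qed.

Section UnitAndIdentity.
Variables (m i : nat) (k0 : fieldType).

Lemma op_one_natural (k l : fieldType) (f : {rmorphism k0 -> k})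
    (g : {rmorphism k0 -> l}) (h : {rmorphism k -> l}) :
  (forall b, h (f b) = g b) -> forall x : KMdeg m i k, KM_map h 1 = 1 :> KM m l.
Proof. by move=> _ _; rewrite kmapE kmap1. Qed.
Definition op_one : operation m i k0 := Operation op_one_natural.

Lemma op_id_natural (k l : fieldType) (f : {rmorphism k0 -> k})
    (g : {rmorphism k0 -> l}) (h : {rmorphism k -> l}) :
  (forall b, h (f b) = g b) -> forall x : KMdeg m i k,
  KM_map h (val x) = val (KMdeg_map h x).
Proof. by []. Qed.
Definition op_id : operation m i k0 := Operation op_id_natural.

Lemma divided_power0 : divided_power 0 op_one.
Proof.
move=> k f s /=; rewrite (big_pred1 set0) ?big_set0 // => A.
by rewrite cards_eq0.
Qed.

Lemma divided_power1 : divided_power 1 op_id.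
Proof.
move=> k f s /=; rewrite KMdeg_sum (big_tnth _ _ s) /=.
rewrite (reindex_omap (fun j => [set j]) (fun A : {set 'I_(size s)} => [pick j in A])) /=.
  apply: eq_big => [j|j _]; last by rewrite big_set1.
  rewrite cards1 eqxx /=; case: pickP => [j'|/(_ j)]; last by rewrite inE eqxx.
  by rewrite inE => /eqP->; rewrite eqxx.
move=> A /cards1P[j ->]; case: pickP => [j'|/(_ j)]; last by rewrite inE eqxx.
by rewrite inE => /eqP->.
Qed.

End UnitAndIdentity.

Lemma eqN_eq0 (m : nat) (k : fieldType) (y : KM m k) : odd m -> y = - y -> y = 0.
Proof.
move=> m_odd yN; have y2 : y *+ 2 = 0 by rewrite mulr2n {2}yN subrr.
have := KM_mulrn y; rewrite -[X in _ *+ X]odd_double_half m_odd mulrSr.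
by rewrite -muln2 mulnC mulrnA y2 mul0rn add0r.
Qed.

Lemma second_difference_anti (R : pzRingType) (s t a b c : R) :
    s * t = - (t * s) ->
    a + b * s + (b + c * s) * t = a + b * t + (b + c * t) * s ->
  c * s * t = - (c * s * t).
Proof.
move=> st h; have e : c * s * t = c * t * s.
  apply: (addrI (a + b * s + b * t)); move: h; rewrite !mulrDl !addrA => ->.
  by rewrite [a + b * t + b * s]addrAC.
by rewrite {1}e -!mulrA st mulrN opprK.
Qed.

Section ConstantDerivative.
Variables (m i : nat) (m_odd : odd m) (k0 : fieldType).
Implicit Types phi : operation m i k0.

(** Go from 0 to x by adding and subtracting symbols. *)
Lemma op_deriv_const phi (k : fieldType) (f : {rmorphism k0 -> k}) (b : KM m k) :
    (forall x, op_deriv m_odd phi k f x = b) ->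
  forall x, phi k f x = phi k f 0 + b * val x.
Proof.
move=> hb x; rewrite -{1}[x]add0r; move: (0 : KMdeg m i k).
elim/KMdeg_ind: x => [y|x z hx hz y|w sw y].
- by rewrite addr0 raddf0 mulr0 addr0.
- have e : phi k f (y - z) = phi k f y - b * val z.
    by rewrite -[y in RHS](subrK z) hz addrK.
  by rewrite addrA addrAC hx e KMdegB mulrBr [RHS]addrA addrAC.
by rewrite (op_derivE m_odd phi f y sw) hb (val_homog_word m sw).
Qed.

(** In odd degree two symbols anticommute, whereas phi(x + s + s') is symmetric
    in s and s'. *)
Lemma op_deriv2_odd phi (k : fieldType) (f : {rmorphism k0 -> k}) x :
  odd i -> op_deriv m_odd (op_deriv m_odd phi) k f x = 0.
Proof.
move=> i_odd; apply: (@coef_eq0 m m_odd (i + i)) => l g w sw.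
rewrite (op_nat _ (g := g \o f : {rmorphism k0 -> l})) //.
move: (g \o f : {rmorphism k0 -> l}) (KMdeg_map g x) => {f g} f {}x.
rewrite -(cat_take_drop i w) big_cat /= mulrA.
have sv : size (take i w) = i by rewrite size_takel // sw leq_addr.
have su : size (drop i w) = i by rewrite size_drop sw addnK.
move: (take i w) (drop i w) sv su => u v su sv {sw w}.
have E (u' v' : words l) (su' : size u' = i) (sv' : size v' = i) :
    phi l f (x + homog i (wsym m u') + homog i (wsym m v')) =
    phi l f x + op_deriv m_odd phi l f x * wsym m u' +
    (op_deriv m_odd phi l f x +
     op_deriv m_odd (op_deriv m_odd phi) l f x * wsym m u') * wsym m v'.
  by rewrite (op_derivE m_odd phi f _ sv') !(op_derivE m_odd _ f x su').
have := E v u sv su; rewrite addrAC (E u v su sv) => e' {E}.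
have anti := anti_words (fun a b : mulgrp l => sym_anti m_odd (val a) (val b)) u v.
rewrite su sv -signr_odd oddM i_odd expr1 mulN1r in anti.
by apply: (eqN_eq0 m_odd); exact: (second_difference_anti anti e').
Qed.

Lemma op_odd phi (k : fieldType) (f : {rmorphism k0 -> k}) x : odd i ->
  phi k f x = kmap f (phi k0 (idfun : {rmorphism k0 -> k0}) 0) +
    kmap f (op_deriv m_odd phi k0 (idfun : {rmorphism k0 -> k0}) 0) * val x.
Proof.
move=> i_odd; rewrite -!op_at0; apply: op_deriv_const => {}x.
rewrite (op_deriv_const (b := 0)) ?mul0r ?addr0 // => {}x.
exact: op_deriv2_odd.
Qed.

End ConstantDerivative.

Lemma operations_odd (m i : nat) (k0 : fieldType) : odd m -> odd i ->
  exists gamma : 'I_2 -> operation m i k0,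
    (forall n : 'I_2, divided_power n (gamma n)) /\ op_basis gamma.
Proof.
move=> m_odd i_odd.
pose gamma (n : 'I_2) := if n == 0 then op_one m i k0 else op_id m i k0.
have sum2 (R : pzRingType) (F : 'I_2 -> R) : \sum_n F n = F ord0 + F (lift ord0 ord0).
  by rewrite big_ord_recl big_ord1.
exists gamma; split=> [|]; first by
  case=> [[|[|n]] hn] //; [exact: divided_power0 | exact: divided_power1].
split=> [s a us eq0|phi].
  pose A n := if n \in s then a n else 0.
  have AE (k : fieldType) (f : {rmorphism k0 -> k}) (x : KMdeg m i k) :
      kmap f (A ord0) + kmap f (A (lift ord0 ord0)) * val x = 0.
    have := op_lincomb_uniq gamma a f x us; rewrite eq0 sum2.
    by rewrite -[X in _ = X + _ -> _]/(kmap f (A ord0) * 1) mulr1 => <-.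
  have A0 : A ord0 = 0.
    have := AE k0 (idfun : {rmorphism k0 -> k0}) 0.
    by rewrite raddf0 mulr0 addr0 kmap_id.
  have A1 : A (lift ord0 ord0) = 0.
    apply: (@coef_eq0 m m_odd i) => k f w sw.
    by have := AE k f (homog i (wsym m w)); rewrite A0 kmap0 add0r val_homog_word.
  move=> n ns; have -> : a n = A n by rewrite /A ns.
  by case: (unliftP ord0 n) => [j ->|-> //]; rewrite (ord1 j).
exists (enum 'I_2), (fun n => if n == 0
  then phi k0 (idfun : {rmorphism k0 -> k0}) 0
  else op_deriv m_odd phi k0 (idfun : {rmorphism k0 -> k0}) 0).
apply: operationP => k f x; rewrite op_lincombE big_enum /= sum2 /= mulr1.
exact: op_odd.
Qed.

(** * Degree zero *)

Section DegreeZero.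
Variables (p : nat) (p_prime : prime p).

Lemma Fp_mulrn_p (c : 'F_p) : c *+ p = 0.
Proof. by rewrite -mulr_natr (pchar_Fp_0 p_prime) mulr0. Qed.

(** Killing all symbols of positive length identifies the degree zero part
    with F_p. *)
Lemma augmentation_subproof (k : fieldType) :
  {F : {rmorphism KM p k -> 'F_p} | forall x, x != 0 -> F (sym p x) = 0}.
Proof.
apply: KM_lift => // *; rewrite ?addr0 ?mulr0 ?oppr0 //.
exact: Fp_mulrn_p.
Qed.

Definition aug (k : fieldType) : {rmorphism KM p k -> 'F_p} :=
  sval (augmentation_subproof k).

Lemma aug_word (k : fieldType) (w : words k) : aug k (wsym p w) = (size w == 0%N)%:R.
Proof.
case: w => [|a w]; first by rewrite big_nil rmorph1.
by rewrite big_cons rmorphM /= (svalP (augmentation_subproof k)) ?(valP a) // mul0r.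
Qed.

Lemma KM_one_neq0 (k : fieldType) : 1 != 0 :> KM p k.
Proof.
apply/eqP => /(congr1 (aug k)); rewrite rmorph1 raddf0 => /eqP.
by rewrite oner_eq0.
Qed.

Lemma aug_kmap (k l : fieldType) (f : {rmorphism k -> l}) (x : KM p k) :
  aug l (kmap f x) = aug k x.
Proof.
elim/KM_ind: x => [x y hx hy|w]; first by rewrite kmapB !raddfB /= hx hy.
rewrite aug_word kmap_word; have := aug_word (map (mulgrp_map f) w).
by rewrite size_map big_map.
Qed.

Notation unit0 k := (symbol p ([tuple] : 0.-tuple (mulgrp k))).

Lemma val_unit0 (k : fieldType) (n : nat) : val (unit0 k *+ n) = n%:R.
Proof. by rewrite KMdegMn val_symbol big_nil. Qed.

Lemma aug_unit0 (k : fieldType) (c : 'F_p) : aug k (val (unit0 k *+ c)) = c.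
Proof. by rewrite val_unit0 rmorph_nat natr_Zp. Qed.

Lemma unit0_aug (k : fieldType) (x : KMdeg p 0 k) :
  x = unit0 k *+ aug k (val x).
Proof.
have unit0p : unit0 k *+ p = 0.
  by apply: val_inj; rewrite KMdegMn KM_mulrn raddf0.
have unit0_nat n : unit0 k *+ n = unit0 k *+ (n%:R : 'F_p).
  rewrite val_Fp_nat // {1}(divn_eq n p) mulrnDr mulnC mulrnA unit0p mul0rn.
  by rewrite add0r.
elim/KMdeg_ind: x => [|x y hx hy|w sw].
- by rewrite raddf0 raddf0.
- have -> : aug k (val (x - y)) = aug k (val x) - aug k (val y).
    by rewrite KMdegB raddfB.
  move: (aug k (val x)) (aug k (val y)) hx hy => c d -> ->.
  apply/eqP; rewrite subr_eq -mulrnDr [X in _ == X]unit0_nat natrD.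
  by rewrite !natr_Zp subrK.
have -> : homog 0 (wsym p w) = unit0 k.
  apply: val_inj; rewrite val_homog_word // val_symbol.
  by rewrite (size0nil sw).
by rewrite val_symbol aug_word; exact: (unit0_nat 1%N).
Qed.

Variable k0 : fieldType.

Lemma op_of_ffun_natural (a : {ffun 'F_p -> KM p k0}) (k l : fieldType)
    (f : {rmorphism k0 -> k}) (g : {rmorphism k0 -> l}) (h : {rmorphism k -> l}) :
  (forall b, h (f b) = g b) -> forall x : KMdeg p 0 k,
  KM_map h (KM_map f (a (aug k (val x)))) = KM_map g (a (aug l (val (KMdeg_map h x)))).
Proof.
by move=> e x; rewrite val_KMdeg_map aug_kmap; apply: KM_map_comp.
Qed.

Definition op_of_ffun (a : {ffun 'F_p -> KM p k0}) : operation p 0 k0 :=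
  Operation (op_of_ffun_natural a).

Lemma op_of_ffunE a (k : fieldType) (f : {rmorphism k0 -> k}) (c : 'F_p) :
  op_of_ffun a k f (unit0 k *+ c) = KM_map f (a c).
Proof. by rewrite /= aug_unit0. Qed.

Lemma op_of_ffunP (a : {ffun _ -> _}) (phi : operation p 0 k0) :
    (forall c : 'F_p, phi k0 (idfun : {rmorphism k0 -> k0}) (unit0 k0 *+ c) = a c) ->
  phi = op_of_ffun a.
Proof.
move=> ha; apply: operationP => k f x.
rewrite (unit0_aug x) op_of_ffunE -ha kmapE (op_nat phi (g := f)) //.
congr (phi _ _ _); apply: val_inj.
rewrite val_KMdeg_map !val_unit0.
by elim: (nat_of_ord _) => [|n IHn]; rewrite ?kmap0 // !mulrS kmapD kmap1 IHn.
Qed.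

Lemma operations_zero :
  exists Theta : {ffun 'F_p -> KM p k0} -> operation p 0 k0,
    [/\ forall (a : {ffun 'F_p -> KM p k0}) (k : fieldType)
            (f : {rmorphism k0 -> k}) (c : 'F_p),
          Theta a k f (symbol p [tuple] *+ c) = KM_map f (a c),
        bijective Theta,
        [/\ forall a b : {ffun 'F_p -> KM p k0},
              Theta [ffun c => a c + b c] = op_add (Theta a) (Theta b),
            forall a b : {ffun 'F_p -> KM p k0},
              Theta [ffun c => a c * b c] = op_mul (Theta a) (Theta b)
          & forall (r : KM p k0) (a : {ffun 'F_p -> KM p k0}),
              Theta [ffun c => r * a c] = op_scale r (Theta a)]
      & op_basis (fun d : 'F_p => Theta [ffun c => (c == d)%:R])].
Proof.
exists op_of_ffun; split.
- exact: op_of_ffunE.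
- exists (fun phi : operation p 0 k0 =>
    [ffun c : 'F_p => phi k0 (idfun : {rmorphism k0 -> k0}) (unit0 k0 *+ c)]).
    by move=> a; apply/ffunP => c; rewrite ffunE op_of_ffunE kmapE kmap_id.
  by move=> phi; apply/esym/op_of_ffunP => c; rewrite ffunE.
- split=> [a b|a b|r a]; apply: operationP => k f x; rewrite /= ffunE !kmapE.
  + exact: kmapD.
  + exact: kmapM.
  exact: kmapM.
split=> [s a us eq0 d ds|phi].
  have := op_lincomb_uniq (fun d : 'F_p => op_of_ffun [ffun c => (c == d)%:R]) a
    (idfun : {rmorphism k0 -> k0}) (unit0 k0 *+ d) us.
  rewrite eq0 /= (bigD1 d) //= big1 ?addr0.
    by rewrite aug_unit0 ffunE eqxx kmapE kmap1 mulr1 kmap_id // ds => <-.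
  move=> c cd; rewrite aug_unit0 ffunE eq_sym (negPf cd).
  by rewrite kmapE kmap0 mulr0.
exists (enum 'F_p), (fun c : 'F_p => phi k0 (idfun : {rmorphism k0 -> k0}) (unit0 k0 *+ c)).
rewrite [LHS](@op_of_ffunP [ffun c : 'F_p =>
   phi k0 (idfun : {rmorphism k0 -> k0}) (unit0 k0 *+ c)]) => [|c]; last by rewrite ffunE.
apply/esym/op_of_ffunP => c; rewrite op_lincombE big_enum ffunE /= (bigD1 c) //= big1 ?addr0.
  by rewrite aug_unit0 ffunE (eqxx c) kmapE kmap1 mulr1 kmap_id.
move=> d dc; rewrite aug_unit0 ffunE (eq_sym c d) (negPf dc).
by rewrite kmapE kmap0 mulr0.
Qed.

End DegreeZero.

(** * The exponential of divided powers *)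

(** A map u from words to square-zero elements, additive in each letter and
    killing the Steinberg words, extends to an exponential
    x |-> prod_w (1 + x_w u(w) T): the exponential of a sum of words is the
    generating series of the divided powers of the sum. *)
Lemma exponential (m : nat) (k : fieldType) (A : comNzRingType) (u : words k -> A) :
    (forall w, u w * u w = 0) -> (forall w, u w *+ m = 0) ->
    (forall s t (a b c : mulgrp k), val c = val a * val b ->
      u (s ++ c :: t) = u (s ++ a :: t) + u (s ++ b :: t)) ->
    (forall s t (a b : mulgrp k), u (s ++ a :: t) * u (s ++ b :: t) = 0) ->
    (forall s t v (a b : mulgrp k), val a + val b = 1 ->
      u (s ++ a :: t ++ b :: v) = 0) ->
  {E : KM m k -> {poly A} |
    [/\ E 0 = 1, forall x y, E (x + y) = E x * E y
      & forall w, E (wsym m w) = 1 + u w *: 'X]}.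
Proof.
move=> u2 um uD uM uS.
have linM a b : a * b = 0 -> (1 + a *: 'X) * (1 + b *: 'X) = 1 + (a + b) *: 'X :> {poly A}.
  move=> ab; rewrite mulrDl mul1r mulrDr mulr1 -scalerAl -scalerAr scalerA ab.
  by rewrite scale0r addr0 scalerDl -addrA [_ *: _ + _]addrC.
pose e w (z : int) : {poly A} := 1 + (u w *~ z) *: 'X.
have eD w a b : e w (a + b) = e w a * e w b.
  by rewrite /e linM ?mulrzDr // mulrzAl mulrzAr u2 !mul0rz.
have e0 w : e w 0 = 1 by rewrite /e mulr0z scale0r addr0.
pose E (g : wordring k) := \prod_(w <- msupp g) e w g@_w.
have EW (d : {fset words k}) g :
    (msupp g `<=` d)%fset -> E g = \prod_(w <- d) e w g@_w.
  move=> le; rewrite [LHS](big_fset_incl _ le) // => w _.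
  by move=> /mcoeff_outdom ->; rewrite e0.
have ED x y : E (x + y) = E x * E y.
  pose d := (msupp x `|` msupp y)%fset.
  rewrite (EW d) ?msuppD_le // (EW d x) ?fsubsetUl // (EW d y) ?fsubsetUr //.
  by rewrite -big_split; apply: eq_bigr => w _; rewrite mcoeffD eD.
have E0 : E 0 = 1 by rewrite /E msupp0 big_seq_fset0.
have EN x : E (- x) * E x = 1 by rewrite -ED addNr.
have EU w : E << w >> = 1 + u w *: 'X.
  by rewrite (EW [fset w]%fset) ?msuppU_le // big_seq_fset1 mcoeffUU.
have EI g : g \in milnor_ideal m k -> E g = 1.
  move=> /milnor_idealP; elim=> {g} [|x y _ hx _ hy|s t a b c abc|s t v a b ab|x] //.
  - by rewrite ED hx mul1r -[RHS](EN y) hy mulr1.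
  - rewrite -addrA -opprD ED mulrC -[RHS](EN (<< s ++ a :: t >> + << s ++ b :: t >>)).
    by congr (_ * _); rewrite ED !EU linM ?uM // -(uD _ _ _ _ _ abc).
  - by rewrite EU uS // scale0r addr0.
  have hn n : E (x *+ n) = \prod_(w <- msupp x) e w (x@_w *+ n).
    elim: n => [|n IHn].
      by rewrite mulr0n E0 big1 // => w _; rewrite mulr0n e0.
    rewrite mulrS ED IHn /E -big_split; apply: eq_bigr => w _.
    by rewrite mulrS eD.
  rewrite hn big1 // => w _.
  by rewrite /e -mulr_natr mulrC mulrzA natz -pmulrn um mul0rz scale0r addr0.
exists (fun x => E (repr x)); split=> [|x y|w].
- by apply: EI; rewrite -[repr 0]subr0 -KM_pi_eq reprK (raddf0 (\pi_(KM m k))).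
- rewrite -ED; set g := repr x + repr y.
  have h : repr (x + y) - g \in milnor_ideal m k.
    by rewrite -KM_pi_eq reprK (raddfD (\pi_(KM m k))) /= !reprK.
  by rewrite -[repr (x + y)](subrK g) ED EI // mul1r.
rewrite -EU -pi_word; set g := << w >>.
have h : repr (\pi_(KM m k) g) - g \in milnor_ideal m k by rewrite -KM_pi_eq reprK.
by rewrite -[repr _](subrK g) ED EI // mul1r.
Qed.

(** * The even part of the Milnor K-ring *)

Definition KM_even (m : nat) (k : fieldType) : {pred KM m k} :=
  KM_part (fun n => ~~ odd n).

Arguments KM_even : clear implicits.

Lemma KM_even_subring m k : subring_closed (KM_even m k).
Proof.
split=> [|x y hx hy|x y hx hy].
- exact: one_part.
- exact: rpredB.
apply: KM_partM hx hy => a b /negPf ha /negPf hb.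
by rewrite oddD ha hb.
Qed.

(** The type carries the hypotheses that make the ring commutative and
    nonzero. *)
Definition evenK (m : nat) (m_odd : odd m) (m_prime : prime m) (k : fieldType) :
  Type := {x : KM m k | x \in KM_even m k}.

Section EvenRing.
Variables (m : nat) (m_odd : odd m) (m_prime : prime m) (k : fieldType).
Local Notation A := (evenK m_odd m_prime k).
HB.instance Definition _ := SubChoice.on A.
HB.instance Definition _ := GRing.SubChoice_isSubPzRing.Build (KM m k)
  (fun x => x \in KM_even m k) A (KM_even_subring m k).

Lemma KM_even_mulC x y : x \in KM_even m k -> y \in KM_even m k -> x * y = y * x.
Proof.
move=> hx hy; elim/KM_part_ind: x / hx => [|x1 x2 h1 h2|v ve].
- by rewrite mul0r mulr0.
- by rewrite mulrBl mulrBr h1 h2.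
elim/KM_part_ind: y / hy => [|x1 x2 h1 h2|w we].
- by rewrite mul0r mulr0.
- by rewrite mulrBl mulrBr h1 h2.
have := anti_words (fun a b : mulgrp k => sym_anti m_odd (val a) (val b)) v w.
by rewrite -signr_odd oddM (negPf ve) mul1r.
Qed.

Lemma evenK_mulC : commutative (@GRing.mul A).
Proof. by move=> x y; apply: val_inj; apply: KM_even_mulC (valP x) (valP y). Qed.
HB.instance Definition _ := GRing.PzRing_hasCommutativeMul.Build A evenK_mulC.

Lemma evenK_one_neq0 : 1 != 0 :> A.
Proof. by apply/eqP => /(congr1 val) /eqP; rewrite rmorph1 raddf0; apply/negP/KM_one_neq0. Qed.
HB.instance Definition _ := GRing.PzSemiRing_isNonZero.Build A evenK_one_neq0.

Lemma evenK0 : val (0 : A) = 0. Proof. exact: raddf0. Qed.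
Lemma evenK1 : val (1 : A) = 1. Proof. exact: rmorph1. Qed.
Lemma evenKD (x y : A) : val (x + y) = val x + val y. Proof. exact: raddfD. Qed.
Lemma evenKM (x y : A) : val (x * y) = val x * val y. Proof. exact: rmorphM. Qed.
Lemma evenKMn (x : A) n : val (x *+ n) = val x *+ n. Proof. exact: raddfMn. Qed.

Lemma evenK_sum (I : Type) (r : seq I) (P : pred I) (F : I -> A) :
  val (\sum_(j <- r | P j) F j) = \sum_(j <- r | P j) val (F j).
Proof. exact: (big_morph val evenKD evenK0). Qed.

Lemma evenK_prod (I : Type) (r : seq I) (P : pred I) (F : I -> A) :
  val (\prod_(j <- r | P j) F j) = \prod_(j <- r | P j) val (F j).
Proof. exact: (big_morph val evenKM evenK1). Qed.

End EvenRing.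

Lemma sandwich_mid (R : pzRingType) (a b d e s : R) :
  s * (b * d) * s = 0 -> a * (s * b) * (d * (s * e)) = 0.
Proof.
move=> h; transitivity (a * (s * (b * d) * s) * e); first by rewrite !mulrA.
by rewrite h mulr0 mul0r.
Qed.

Lemma word_common_letter m (k : fieldType) (c : mulgrp k) (v w : words k) :
  odd m -> c \in v -> c \in w -> wsym m v * wsym m w = 0.
Proof.
move=> m_odd /splitPr[v1 v2] /splitPr[w1 w2].
rewrite !big_cat !big_cons /=.
have := sym_sandwich m_odd (val c) (wsym m v2 * wsym m w1).
move: (sym m (val c)) (wsym m v1) (wsym m v2) (wsym m w1) (wsym m w2) => s a b d e h.
exact: sandwich_mid.
Qed.

Lemma coef_prod_linear (R : comNzRingType) (I : finType) (v : I -> R) n :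
  (\prod_j (v j *: 'X + 1))`_n =
    \sum_(B : {set I} | #|B| == n) \prod_(j in B) v j.
Proof.
rewrite bigA_distr coef_sum [RHS]big_mkcond; apply: eq_bigr => B _ /=.
rewrite -big_mkcond scaler_prod prodr_const coefZ coefXn eq_sym.
by case: eqP => _; rewrite ?mulr1 ?mulr0.
Qed.

(** In even degree at least two, all words of the given length have square
    zero and commute, and two words that differ in one letter share another. *)
Lemma divided_power_coefs (m i : nat) (m_odd : odd m) (m_prime : prime m)
    (k : fieldType) : (2 <= i)%N -> ~~ odd i ->
  {c : KMdeg m i k -> nat -> KM m k |
    [/\ forall n, c 0 n = (n == 0%N)%:R,
        forall x (w : words k), size w = i -> forall n,
          c (x + homog i (wsym m w)) n =
            c x n + (if n is n'.+1 then c x n' * wsym m w else 0)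
      & forall n (s : seq (i.-tuple (mulgrp k))),
          c (\sum_(t <- s) symbol m t) n =
          \sum_(B : {set 'I_(size s)} | #|B| == n)
            \prod_(j in B) val (symbol m (tnth (in_tuple s) j))]}.
Proof.
move=> i2 i_even; pose A := evenK m_odd m_prime k.
pose u (w : words k) : A := if size w == i then insubd (0 : A) (wsym m w) else 0.
have uE w : val (u w) = if size w == i then wsym m w else 0.
  rewrite /u; case: eqP => [sw|_]; last exact: evenK0.
  by rewrite insubdK // word_part // sw.
have uN w : size w != i -> u w = 0 by rewrite /u => /negPf->.
have [||||| E [E0 ED EU]] := @exponential m k A u.
- move=> w; apply: val_inj; rewrite evenKM evenK0 uE; case: eqP => [sw|_]; last by rewrite mul0r.
  case: w sw i2 => [<-//|a w _ _].
  exact: word_common_letter (mem_head _ _) (mem_head _ _).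
- by move=> w; apply: val_inj; rewrite evenKMn KM_mulrn evenK0.
- move=> s t a b c e; apply: val_inj; rewrite evenKD !uE !size_cat /=.
  case: eqP => _; last by rewrite addr0.
  by rewrite !big_cat !big_cons /= e symM ?(valP a) ?(valP b) // mulrDl mulrDr.
- move=> s t a b; apply: val_inj; rewrite evenKM evenK0 !uE !size_cat /=.
  case: eqP => [st|_]; last by rewrite mul0r.
  have [c cst] : exists c, c \in s ++ t.
    case: s st => [|c s'] st; last by exists c; rewrite mem_head.
    case: t st => [st|c t' _]; last by exists c; rewrite mem_head.
    by move: i2; rewrite -st.
  by apply: (@word_common_letter m k c) => //; rewrite mem_cat inE;
    move: cst; rewrite mem_cat => /orP[->|->]; rewrite ?orbT.
- move=> s t v a b ab; apply: val_inj; rewrite evenK0 uE; case: eqP => // _.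
  by rewrite -pi_word; apply/pi_rel/MilnorRelSteinberg.
pose c (x : KMdeg m i k) n := val (E (val x))`_n.
exists c; split.
- move=> n; rewrite /c raddf0 E0 coef1; case: (n == 0%N); last exact: evenK0.
  exact: evenK1.
- move=> x w sw n; rewrite /c KMdegD val_homog_word // ED EU mulrDr mulr1 -scalerAr.
  rewrite coefD coefZ coefMX evenKD; case: n => [|n]; first by rewrite mulr0 evenK0.
  by rewrite evenK_mulC evenKM uE sw eqxx.
move=> n s; rewrite /c KMdeg_sum.
have -> : E (\sum_(t <- s) val (symbol m t)) = \prod_(t <- s) (u t *: 'X + 1).
  elim: s => [|t s IHs]; first by rewrite !big_nil.
  rewrite !big_cons ED IHs; congr (_ * _).
  by rewrite addrC; exact: etrans (congr1 E (val_symbol m t)) (EU t).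
rewrite (big_tnth _ _ s) coef_prod_linear evenK_sum; apply: eq_bigr => B _.
rewrite evenK_prod; apply: eq_bigr => j _.
by rewrite uE size_tuple eqxx val_symbol.
Qed.

(** * Symbols of even degree *)

(** Invert the first entry. *)
Lemma symbol_opp (m i : nat) (k : fieldType) (t : i.-tuple (mulgrp k)) :
  (0 < i)%N -> exists t' : i.-tuple (mulgrp k), symbol m t' = - symbol m t.
Proof.
case: i t => // i t _; case/tupleP: t => a t.
have [b eb] := mulgrpP (invr_neq0 (valP a)).
exists [tuple of b :: t]; apply: val_inj.
rewrite KMdegN !val_symbol /= !big_cons -eb symV.
exact: mulNr.
Qed.

Lemma KMdeg_sum_symbols (m i : nat) (k : fieldType) (x : KMdeg m i k) :
  (0 < i)%N -> exists s : seq (i.-tuple (mulgrp k)), x = \sum_(t <- s) symbol m t.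
Proof.
move=> i_gt0; elim/KMdeg_ind: x => [|x y [s ->] [s' ->]|w sw].
- by exists [::]; rewrite big_nil.
- have [s'' e] : exists s'' : seq (i.-tuple (mulgrp k)),
      \sum_(t <- s'') symbol m t = - \sum_(t <- s') symbol m t.
    elim: s' => [|t s' [s'' IHs]]; first by exists [::]; rewrite !big_nil oppr0.
    have [t' et] := symbol_opp m t i_gt0.
    by exists (t' :: s''); rewrite !big_cons IHs et opprD.
  by exists (s ++ s''); rewrite big_cat /= e.
have sw' : size w == i by rewrite sw.
exists [:: Tuple sw']; rewrite big_seq1; apply: val_inj.
by rewrite val_symbol val_homog_word.
Qed.

Lemma KMdeg_symbol_ind (m i : nat) (k : fieldType) (P : KMdeg m i k -> Prop) :
    (0 < i)%N -> P 0 ->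
    (forall x (w : words k), size w = i -> P x -> P (x + homog i (wsym m w))) ->
  forall x, P x.
Proof.
move=> i_gt0 P0 PD x; have [s ->] := KMdeg_sum_symbols x i_gt0.
elim: s => [|t s IHs]; first by rewrite big_nil.
rewrite big_cons addrC; suff -> : symbol m t = homog i (wsym m t).
  by apply: PD; rewrite ?size_tuple.
by apply: val_inj; rewrite val_homog_word ?size_tuple // val_symbol.
Qed.

Section Even.
Variables (m i : nat) (m_odd : odd m) (m_prime : prime m).
Hypotheses (i_gt1 : (2 <= i)%N) (i_even : ~~ odd i).
Let i_gt0 : (0 < i)%N := ltnW i_gt1.

Let symbol_ind (k : fieldType) (P : KMdeg m i k -> Prop) : P 0 ->
    (forall x (w : words k), size w = i -> P x -> P (x + homog i (wsym m w))) ->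
  forall x, P x.
Proof. exact: KMdeg_symbol_ind. Qed.

Definition dp (k : fieldType) : KMdeg m i k -> nat -> KM m k :=
  sval (divided_power_coefs m_odd m_prime k i_gt1 i_even).

Lemma dp_at0 (k : fieldType) n : dp (0 : KMdeg m i k) n = (n == 0%N)%:R.
Proof. by rewrite /dp; case: (divided_power_coefs _ _ _ _ _) => c [h _ _] /=; apply: h. Qed.

Lemma dpD (k : fieldType) (x : KMdeg m i k) (w : words k) n : size w = i ->
  dp (x + homog i (wsym m w)) n =
    dp x n + (if n is n'.+1 then dp x n' * wsym m w else 0).
Proof.
by rewrite /dp; case: (divided_power_coefs _ _ _ _ _) => c [_ h _] /= sw; apply: h.
Qed.

Lemma dp_sum (k : fieldType) n (s : seq (i.-tuple (mulgrp k))) :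
  dp (\sum_(t <- s) symbol m t) n =
    \sum_(B : {set 'I_(size s)} | #|B| == n)
      \prod_(j in B) val (symbol m (tnth (in_tuple s) j)).
Proof. by rewrite /dp; case: (divided_power_coefs _ _ _ _ _) => c [_ _ h] /=; apply: h. Qed.

Lemma dp_kmap (k l : fieldType) (h : {rmorphism k -> l}) (x : KMdeg m i k) n :
  kmap h (dp x n) = dp (KMdeg_map h x) n.
Proof.
elim/symbol_ind: x n => [|x w sw IHx] n.
  rewrite KMdeg_map0 !dp_at0; case: (n == 0%N); [exact: kmap1 | exact: kmap0].
rewrite KMdeg_mapD KMdeg_map_word // !dpD ?size_map // kmapD IHx; congr (_ + _).
case: n => [|n]; first exact: kmap0.
by rewrite kmapM IHx kmap_word big_map.
Qed.

Lemma dp_part (k : fieldType) (x : KMdeg m i k) n :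
  dp x n \in KM_part (pred1 (n * i)%N).
Proof.
elim/symbol_ind: x n => [|x w sw IHx] n.
  by rewrite dp_at0; case: n => [|n] /=; rewrite ?one_part ?rpred0.
rewrite dpD //; apply: rpredD => //; case: n => [|n]; first exact: rpred0.
have dec a b : pred1 (n * i)%N a -> pred1 i b -> pred1 (n.+1 * i)%N (a + b)%N.
  by move=> /eqP-> /eqP->; rewrite /= mulSn addnC.
by apply: KM_partM dec (IHx n) _; rewrite word_part ?sw /=.
Qed.

Lemma dp_vanish (k : fieldType) (x : KMdeg m i k) :
  {N : nat | forall n, (N <= n)%N -> dp x n = 0}.
Proof.
apply: cid; elim/symbol_ind: x => [|x w sw [N IHx]].
  by exists 1%N => n; rewrite dp_at0; case: n.
exists N.+1 => [[|n]] //; rewrite ltnS => Nn.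
by rewrite dpD // !IHx ?mul0r ?addr0 // (leq_trans Nn).
Qed.

Variable k0 : fieldType.
Local Notation op := (operation m i k0).
Implicit Types (phi : op) (b : nat -> KM m k0).

Lemma gamma_natural n (k l : fieldType) (f : {rmorphism k0 -> k})
    (g : {rmorphism k0 -> l}) (h : {rmorphism k -> l}) :
  (forall a, h (f a) = g a) -> forall x : KMdeg m i k,
  KM_map h (dp x n) = dp (KMdeg_map h x) n.
Proof. by move=> _ x; rewrite kmapE dp_kmap. Qed.

Definition gamma n : op := Operation (gamma_natural n).

Lemma gamma_divided_power n : divided_power n (gamma n).
Proof. by move=> k f s; apply: dp_sum. Qed.

(** The sum of the b_n gamma_n at x, cut off where the divided powers of x
    vanish; every larger bound gives the same value. *)
Definition series_at b (k : fieldType) (f : {rmorphism k0 -> k}) (x : KMdeg m i k) :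
    KM m k :=
  \sum_(n < sval (dp_vanish x)) kmap f (b n) * dp x n.

Lemma series_atE b (k : fieldType) (f : {rmorphism k0 -> k}) (x : KMdeg m i k) N :
    (forall n, (N <= n)%N -> kmap f (b n) * dp x n = 0) ->
  series_at b f x = \sum_(n < N) kmap f (b n) * dp x n.
Proof.
rewrite /series_at; case: (dp_vanish x) => N' /= h' h.
have trunc M M' (F : nat -> KM m k) : (forall n, (M <= n)%N -> F n = 0) ->
    \sum_(n < M) F n = \sum_(n < M + M') F n.
  move=> F0; rewrite big_split_ord /= [X in _ + X]big1 ?addr0 // => n _.
  by rewrite F0 // leq_addr.
rewrite (trunc N' N (fun n => kmap f (b n) * dp x n)); last first.
  by move=> n /h' ->; rewrite mulr0.
by rewrite (trunc N N' (fun n => kmap f (b n) * dp x n)) // addnC.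
Qed.

Lemma series_at0 b (k : fieldType) (f : {rmorphism k0 -> k}) :
  series_at b f 0 = kmap f (b 0%N).
Proof.
rewrite (@series_atE b k f 0 1) ?big_ord1 ?dp_at0 ?mulr1 // => [[|n]] // _.
by rewrite dp_at0 mulr0.
Qed.

Lemma series_atD b (k : fieldType) (f : {rmorphism k0 -> k}) (x : KMdeg m i k)
    (w : words k) : size w = i ->
  series_at b f (x + homog i (wsym m w)) =
    series_at b f x + series_at (fun n => b n.+1) f x * wsym m w.
Proof.
move=> sw; have [N hN] := dp_vanish x.
rewrite (@series_atE b k f x N.+1); last first.
  by move=> n /ltnW /hN ->; rewrite mulr0.
rewrite (@series_atE _ k f x N); last by move=> n /hN ->; rewrite mulr0.
rewrite (@series_atE b k f _ N.+1); last first.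
  move=> [|n] //; rewrite ltnS => Nn.
  by rewrite dpD // !hN ?mul0r ?addr0 ?mulr0 // (leq_trans Nn).
rewrite mulr_suml big_ord_recl [in RHS]big_ord_recl !dpD // addr0 -addrA.
congr (_ + _); rewrite -big_split; apply: eq_bigr => n _ /=.
by rewrite dpD // mulrDr mulrA.
Qed.

Lemma series_at_natural b (k l : fieldType) (f : {rmorphism k0 -> k})
    (g : {rmorphism k0 -> l}) (h : {rmorphism k -> l}) :
  (forall a, h (f a) = g a) -> forall x : KMdeg m i k,
  KM_map h (series_at b f x) = series_at b g (KMdeg_map h x).
Proof.
move=> e x; rewrite kmapE; have [N hN] := dp_vanish x.
rewrite (@series_atE b k f x N); last by move=> n /hN ->; rewrite mulr0.
rewrite (@series_atE b l g _ N); last first.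
  by move=> n /hN h0; rewrite -dp_kmap h0 kmap0 mulr0.
rewrite (big_morph _ (kmapD h) (kmap0 _ h)); apply: eq_bigr => n _.
by rewrite kmapM (kmap_comp _ e) dp_kmap.
Qed.

Definition op_of_series b : op := Operation (series_at_natural b).

Lemma op_seriesP b phi :
  op_series gamma b phi <-> phi = op_of_series b.
Proof.
split=> [h|-> k f x].
  apply: operationP => k f x /=; have [N hN] := h k f x.
  have [N' hN'] := dp_vanish x.
  rewrite (hN (N + N')%N) ?leq_addr // (@series_atE b k f x (N + N')); last first.
    by move=> n /(leq_trans (leq_addl _ _)) /hN' ->; rewrite mulr0.
  by apply: eq_bigr => n _; rewrite kmapE.
have [N hN] := dp_vanish x; exists N => M NM /=.
rewrite (@series_atE b k f x M); first by apply: eq_bigr => n _; rewrite kmapE.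
by move=> n /(leq_trans NM) /hN ->; rewrite mulr0.
Qed.

Definition taylor phi n : KM m k0 :=
  iter n (fun psi : op => op_deriv m_odd psi) phi k0 (idfun : {rmorphism k0 -> k0}) 0.

(** Both sides satisfy psi(x + s) = psi(x) + psi'(x) s for every symbol s, where
    the derivative shifts the Taylor coefficients, and agree at x = 0. *)
Lemma op_taylor phi : phi = op_of_series (taylor phi).
Proof.
apply: operationP => k f x /=.
elim/symbol_ind: x phi => [|x w sw IHx] phi.
  by rewrite series_at0 op_at0.
have e : taylor (op_deriv m_odd phi) = (fun n => taylor phi n.+1).
  by apply/funext => n; rewrite /taylor iterSr.
rewrite (series_atD _ f x sw) -e -(IHx phi) -(IHx (op_deriv m_odd phi)).
exact: op_derivE.
Qed.

(** Compare the values at 0, then the derivatives, which shift b and c. *)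
Lemma series_at_inj b c :
    (forall (k : fieldType) (f : {rmorphism k0 -> k}) (x : KMdeg m i k),
      series_at b f x = series_at c f x) ->
  b = c.
Proof.
move=> bc; apply/funext => n.
elim: n b c bc => [|n IHn] b c bc.
  by have := bc k0 (idfun : {rmorphism k0 -> k0}) 0; rewrite !series_at0 !kmap_id.
apply: (IHn (fun n => b n.+1) (fun n => c n.+1)) => k f x.
apply: (@coef_inj m m_odd i) => l g w sw.
have nat_b (a : nat -> KM m k0) :
    kmap g (series_at a f x) =
      series_at a (g \o f : {rmorphism k0 -> l}) (KMdeg_map g x).
  by rewrite -kmapE; apply: series_at_natural.
rewrite !nat_b; move: (g \o f : {rmorphism k0 -> l}) (KMdeg_map g x) => f' x'.
have := bc l f' (x' + homog i (wsym m w)).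
by rewrite !(series_atD _ f' x' sw) (bc l f' x') => /addrI.
Qed.

Lemma lincomb_series (s : seq nat) (a : nat -> KM m k0) : uniq s ->
  op_lincomb gamma s a = op_of_series (fun n => if n \in s then a n else 0).
Proof.
move=> us; apply: operationP => k f x /=; rewrite op_lincombE.
pose N := (\max_(n <- s) n).+1.
have sN n : n \in s -> (n < N)%N by move=> ns; rewrite ltnS; apply: leq_bigmax_seq.
rewrite (@series_atE _ k f x N) => [|n Nn]; last first.
  by case: ifP => [/sN|]; rewrite ?kmap0 ?mul0r // ltnNge Nn.
rewrite -(big_mkord predT (fun n => kmap f (if n \in s then a n else 0) * dp x n)).
rewrite (perm_big [seq n <- index_iota 0 N | n \in s]); last first.
  apply: (uniq_perm us (filter_uniq _ (iota_uniq _ _))) => n.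
  by rewrite mem_filter mem_iota add0n subn0; case: (boolP (n \in s)) => // /sN ->.
rewrite big_filter big_mkcond /=; apply: eq_bigr => n _.
by case: ifP => _; rewrite ?kmap0 ?mul0r.
Qed.

Lemma gamma_free : op_free gamma.
Proof.
move=> s a us; rewrite lincomb_series // => eq0 n ns.
have e0 : (fun n => if n \in s then a n else 0) = (fun=> 0).
  apply: series_at_inj => k f x.
  have /(congr1 (fun psi : op => psi k f x)) /= -> := eq0.
  by rewrite /series_at big1 // => j _; rewrite kmap0 mul0r.
by have := congr1 (fun g => g n) e0; rewrite /= ns.
Qed.

(** Each derivative lowers the bound on the degree by i, so that the Taylor
    coefficients are eventually zero. *)
Lemma bounded_span phi : op_bounded phi -> op_span gamma phi.
Proof.
move=> [d hd].
have part_iter n : forall (k : fieldType) (f : {rmorphism k0 -> k}) x,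
    iter n (fun psi : op => op_deriv m_odd psi) phi k f x
      \in KM_part (fun j => j + n * i <= d)%N.
  elim: n => [|n IHn] k f x; first by apply: KM_partS (hd k f x) => j; rewrite addn0.
  apply: KM_partS (op_deriv_part m_odd IHn f x) => j.
  by rewrite -addnA mulSn.
have taylor0 n : (d < n)%N -> taylor phi n = 0.
  move=> dn; apply: KM_part0; apply: KM_partS (part_iter n k0 _ 0) => j.
  move=> jd; have : (n <= d)%N.
    by apply: leq_trans jd; rewrite (leq_trans _ (leq_addl _ _)) // leq_pmulr.
  by rewrite leqNgt dn.
exists (iota 0 d.+1), (taylor phi).
rewrite lincomb_series ?iota_uniq // {1}(op_taylor phi); congr op_of_series.
apply/funext => n; rewrite mem_iota /= add0n ltnS.
by case: leqP => // /taylor0.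
Qed.

Lemma span_bounded phi : op_span gamma phi -> op_bounded phi.
Proof.
move=> [s [a ->]]; elim: s => [|n s [d hd]].
  by exists 0%N => k f x; rewrite op_lincombE big_nil rpred0.
have [e he] := KM_part_degreeP (a n).
exists (maxn (e + n * i) d) => k f x; rewrite op_lincombE big_cons -op_lincombE.
apply: rpredD; last first.
  by apply: KM_partS (hd k f x) => j jd; rewrite leq_max jd orbT.
have dec u v : (u <= e)%N -> pred1 (n * i)%N v -> (u + v <= maxn (e + n * i) d)%N.
  by move=> ue /eqP->; rewrite leq_max leq_add2r ue.
exact: KM_partM dec (kmap_part f he) (dp_part x n).
Qed.

End Even.

Lemma operations_even (m i : nat) (k0 : fieldType) :
    odd m -> prime m -> (2 <= i)%N -> ~~ odd i ->
  exists gamma : nat -> operation m i k0,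
    [/\ forall n : nat, divided_power n (gamma n),
        op_free gamma,
        forall phi : operation m i k0, op_bounded phi <-> op_span gamma phi,
        forall phi : operation m i k0,
          exists! a : nat -> KM m k0, op_series gamma a phi
      & forall a : nat -> KM m k0,
          exists! phi : operation m i k0, op_series gamma a phi].
Proof.
move=> m_odd m_prime i2 i_even.
exists (gamma m_odd m_prime i2 i_even k0); split.
- exact: gamma_divided_power.
- exact: gamma_free.
- by move=> phi; split; [apply: bounded_span | apply: span_bounded].
- move=> phi; exists (taylor m_odd phi); split; first exact/op_seriesP/op_taylor.
  move=> a /op_seriesP ea.
  apply: (@series_at_inj m i m_odd m_prime i2 i_even k0) => k f x.
  have /(congr1 (fun psi : operation m i k0 => psi k f x)) := ea.
  by rewrite {1}(op_taylor m_odd m_prime i2 i_even phi).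
move=> a; exists (op_of_series m_odd m_prime i2 i_even a); split; first exact/op_seriesP.
by move=> phi /op_seriesP ->.
Qed.

Theorem theorem1 (k0 : fieldType) (p : nat) (p_prime : prime p)
    (p_odd : odd p) :
  [/\ exists Theta : {ffun 'F_p -> KM p k0} -> operation p 0 k0,
        [/\ forall (a : {ffun 'F_p -> KM p k0}) (k : fieldType)
                (f : {rmorphism k0 -> k}) (c : 'F_p),
              Theta a k f (symbol p [tuple] *+ c) = KM_map f (a c),
            bijective Theta,
            [/\ forall a b : {ffun 'F_p -> KM p k0},
                  Theta [ffun c => a c + b c] = op_add (Theta a) (Theta b),
                forall a b : {ffun 'F_p -> KM p k0},
                  Theta [ffun c => a c * b c] = op_mul (Theta a) (Theta b)
              & forall (r : KM p k0) (a : {ffun 'F_p -> KM p k0}),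
                  Theta [ffun c => r * a c] = op_scale r (Theta a)]
          & op_basis (fun d : 'F_p => Theta [ffun c => (c == d)%:R])],
      forall i : nat, (1 <= i)%N -> odd i ->
        exists gamma : 'I_2 -> operation p i k0,
          (forall n : 'I_2, divided_power n (gamma n)) /\ op_basis gamma
    & forall i : nat, (2 <= i)%N -> ~~ odd i ->
        exists gamma : nat -> operation p i k0,
          [/\ forall n : nat, divided_power n (gamma n),
              op_free gamma,
              forall phi : operation p i k0,
                op_bounded phi <-> op_span gamma phi,
              forall phi : operation p i k0,
                exists! a : nat -> KM p k0, op_series gamma a phi
            & forall a : nat -> KM p k0,
                exists! phi : operation p i k0, op_series gamma a phi]].
Proof.
split.
- exact: operations_zero.
- by move=> i _; apply: operations_odd.
by move=> i; apply: operations_even.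
Qed.
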